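(* Let $M$ be a monoid and let $K$ be a rigid free left $M$-simplicial set with an $M$-equivariant collapsing scheme $(E,R,C,c,i)$, with associated basis $B$ and $E^B=E\cap B$. Then there is a free left $M$-CW complex $Y$ such that $Y$ is $M$-homotopy equivalent to the geometric realisation $|K|$, the cells of $Y$ are in bijective correspondence with $E$, and under this bijective correspondence the set of $n$-cells of $Y$ is a free left $M$-set with basis $E_n^B$ for all $n$.
   Context: Collapsing schemes. Let $K$ be a simplicial set with face maps $d_j$ and degeneracy maps $s_j$; an $n$-cell of $K$ is a non-degenerate $n$-simplex (these correspond to the $n$-cells of the CW complex $|K|$). A collapsing scheme $(E,R,C,c,i)$ for $K$ consists of a partition of the cells into essential ($E$), redundant ($R$) and collapsible ($C$) cells, all collapsible cells having dimension at least one, together with maps $c,i$ assigning to each redundant $n$-cell $\tau$ a collapsible $(n+1)$-cell $c(\tau)$ and a number $i(\tau)\in\{0,\dots,n+1\}$ with $\tau=d_{i(\tau)}(c(\tau))$. For redundant $n$-cells $\tau,\tau'$ write $\tau'\prec\tau$ if $\tau'=d_j(c(\tau))$ for some $j\ne i(\tau)$. It is required that (C1) for all $n$, $c$ is a bijection $R_n\to C_{n+1}$ (subscripts denote the cells of that dimension); (C2) there is no infinite descending chain $\tau\succ\tau'\succ\tau''\succ\cdots$ of redundant $n$-cells. The height of a redundant cell $\tau$ is the maximum length $k$ of a chain $\tau=\tau_0\succ\tau_1\succ\cdots\succ\tau_k$ (finite by (C2) and König's lemma). $M$-equivariant collapsing schemes. A rigid left $M$-simplicial set is a simplicial set with a left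 $M$-action by simplicial morphisms which preserves non-degeneracy of simplices; it is free if for each $n$ the set of $n$-cells is a free left $M$-set. A collapsing scheme for a rigid free left $M$-simplicial set $K$ is $M$-equivariant if: (A1) $M$ acts by simplicial morphisms (maps $n$-simplices to $n$-simplices and commutes with the $d_j$, $s_j$). (A2) For every $n$-simplex $\sigma$ and $m\in M$, $\sigma$ is a cell iff $m\sigma$ is a cell, in which case $\sigma\in E$ (resp. $R$, $C$) iff $m\sigma\in E$ (resp. $R$, $C$). (A3) $c(m\sigma)=mc(\sigma)$ for all $\sigma\in R_n$, $m\in M$. (A4) There is a subset $B\subseteq E\cup R\cup C$ such that for all $n$ the set of $n$-cells is a free left $M$-set with basis $B_n$ (the $n$-cells in $B$). Put $E^B=E\cap B$, $R^B=R\cap B$, $C^B=C\cap B$; then $E_n$ is a free left $M$-set with basis $E^B_n$, and similarly for $R_n$, $C_n$. (A5) For every matched pair $(\sigma,\tau)$ with $\sigma\in R$ and $\tau=c(\sigma)$, one has $\sigma\in R^B$ iff $\tau\in C^B$. (A6) $\mathrm{height}(\tau)=\mathrm{height}(m\tau)$ for every redundant cell $\tau$ and $m\in M$. $M$-CW complexes. An $M$-space is a space with a continuous left action of the discrete monoid $M$. A free left $M$-CW complex is an $M$-space $X=\varinjlim X_n$ (along inclusions) where $X_0=P_0$ is a free $M$-set (discrete) and, for $n\ge1$, $X_n$ is a pushout of $M$-spaces $X_n=X_{n-1}\cup_{P_n\times S^{n-1}}(P_n\times B^n)$ along an $M$-equivariant continuous map $P_n\times S^{n-1}\to X_{n-1}$,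 with $P_n$ a free $M$-set and trivial actions on $B^n$, $S^{n-1}$; its set of $n$-cells is in bijection with $P_n$. For a rigid free left $M$-simplicial set $K$, the geometric realisation $|K|$ is a free left $M$-CW complex via $m[(x,u)]=[(mx,u)]$ for a simplex $x$ and a point $u$ of the standard topological simplex. Two $M$-spaces $X,Y$ are $M$-homotopy equivalent if there are $M$-equivariant continuous $f\colon X\to Y$, $g\colon Y\to X$ with $gf$ and $fg$ homotopic to the identities through $M$-equivariant homotopies $X\times I\to X$, $Y\times I\to Y$ ($I$ with trivial action). *)

(* Defs.v *)
From Stdlib Require Import Relation_Operators.
From mathcomp Require Import all_boot all_order all_algebra.
From mathcomp Require Import generic_quotient.
From mathcomp Require Import all_classical all_reals topology.

Set Implicit Arguments.
Unset Strict Implicit.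
Unset Printing Implicit Defensive.

Import Order.TTheory GRing.Theory Num.Theory.
Import numFieldTopology.Exports.
Local Open Scope classical_set_scope.
Local Open Scope quotient_scope.
Local Open Scope ring_scope.

Record mset (M : monoidType) := MSet {
  mset_sort :> choiceType;
  mact : M -> mset_sort -> mset_sort;
  mact1 : forall x, mact 1%g x = x;
  mactM : forall (a b : M) x, mact (a * b)%g x = mact a (mact b x)
}.

(* The action map M x B -> A is bijective; in particular B is contained in A
   (take the unit of M) and A is stable under the action. *)
Definition free_with_basis (M : monoidType) (T : Type) (act : M -> T -> T)
    (A B : set T) : Prop :=
  set_bij ([set: M] `*` B) A (fun p => act p.1 p.2).

Definition is_free (M : monoidType) (T : Type) (act : M -> T -> T)
    (A : set T) : Prop :=
  exists B : set T, free_with_basis act A B.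

(* The simplicial identities are indexed so that every face and degeneracy has
   its index in the right ordinal: [lift ord0 j] is j + 1 and
   [widen_ord (leqnSn _) i] is i. *)
Record sset := SSet {
  simplices :> nat -> choiceType;
  face : forall n, 'I_n.+2 -> simplices n.+1 -> simplices n;
  degen : forall n, 'I_n.+1 -> simplices n -> simplices n.+1;
  face_face : forall n (i j : 'I_n.+2) (x : simplices n.+2), (i <= j)%N ->
    face i (face (lift ord0 j) x) = face j (face (widen_ord (leqnSn _) i) x);
  degen_degen : forall n (i j : 'I_n.+1) (x : simplices n), (i <= j)%N ->
    degen (widen_ord (leqnSn _) i) (degen j x)
    = degen (lift ord0 j) (degen i x);
  face_degen_lt : forall n (i : 'I_n.+2) (j : 'I_n.+1) (x : simplices n.+1),
    (i <= j)%N ->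
    face (widen_ord (leqnSn _) i) (degen (lift ord0 j) x)
    = degen j (face i x);
  face_degen_eq : forall n (j : 'I_n.+1) (x : simplices n),
    face (widen_ord (leqnSn _) j) (degen j x) = x;
  face_degen_eqS : forall n (j : 'I_n.+1) (x : simplices n),
    face (lift ord0 j) (degen j x) = x;
  face_degen_gt : forall n (i : 'I_n.+2) (j : 'I_n.+1) (x : simplices n.+1),
    (j < i)%N ->
    face (lift ord0 i) (degen (widen_ord (leqnSn _) j) x)
    = degen j (face i x)
}.

Definition degenerate (K : sset) (n : nat) : set (K n) :=
  match n return set (K n) with
  | 0 => set0
  | _.+1 => [set x | exists j y, x = degen j y]
  end.

Definition cells (K : sset) (n : nat) : set (K n) := ~` @degenerate K n.

Record rigid_msset (M : monoidType) := RigidMSSet {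
  msset_sset :> sset;
  sact : forall n, M -> msset_sset n -> msset_sset n;
  sact1 : forall n (x : msset_sset n), sact 1%g x = x;
  sactM : forall n (a b : M) (x : msset_sset n),
    sact (a * b)%g x = sact a (sact b x);
  sact_face : forall n (m : M) (j : 'I_n.+2) (x : msset_sset n.+1),
    sact m (face j x) = face j (sact m x);
  sact_degen : forall n (m : M) (j : 'I_n.+1) (x : msset_sset n),
    sact m (degen j x) = degen j (sact m x);
  sact_cell : forall n (m : M) (x : msset_sset n),
    cells x -> cells (sact m x)
}.

Definition free_msset (M : monoidType) (K : rigid_msset M) : Prop :=
  forall n, is_free (@sact M K n) (@cells K n).

Definition redundant_prec (K : sset) (Rd : forall n, set (K n))
    (c : forall n, K n -> K n.+1) (i : forall n, K n -> 'I_n.+2)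
    (n : nat) (x y : K n) : Prop :=
  [/\ Rd n x, Rd n y & exists2 j, j != i n y & x = face j (c n y)].

(* [cmap] and [imap] are only meaningful on redundant cells; their values
   elsewhere are irrelevant. *)
Record collapsing_scheme (K : sset) := CollapsingScheme {
  essential : forall n, set (K n);
  redundant : forall n, set (K n);
  collapsible : forall n, set (K n);
  cmap : forall n, K n -> K n.+1;
  imap : forall n, K n -> 'I_n.+2;
  scheme_cover : forall n, @essential n `|` @redundant n `|` @collapsible n = @cells K n;
  scheme_ess_red : forall n, @essential n `&` @redundant n = set0;
  scheme_ess_col : forall n, @essential n `&` @collapsible n = set0;
  scheme_red_col : forall n, @redundant n `&` @collapsible n = set0;
  scheme_col0 : @collapsible 0%N = set0;
  scheme_face : forall n (x : K n), redundant x -> x = face (imap x) (cmap x);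
  scheme_bij : forall n, set_bij (@redundant n) (@collapsible n.+1) (@cmap n);
  scheme_wf : forall n, ~ exists x : nat -> K n,
    forall k, redundant_prec (@redundant) (@cmap) (@imap) (x k.+1) (x k)
}.

Section height.
Variables (K : sset) (S : collapsing_scheme K).

Definition scheme_prec (n : nat) (x y : K n) : Prop :=
  redundant_prec (@redundant K S) (@cmap K S) (@imap K S) x y.

Definition has_chain (n : nat) (x : K n) (k : nat) : Prop :=
  exists2 f : nat -> K n, f 0%N = x &
    forall l, (l < k)%N -> scheme_prec (f l.+1) (f l).

Definition height (n : nat) (x : K n) : nat :=
  xget 0%N [set k | has_chain x k /\ forall l, has_chain x l -> (l <= k)%N].

End height.

(* That M acts by simplicial morphisms is part of [rigid_msset]. *)
Record equivariant_scheme (M : monoidType) (K : rigid_msset M)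
    (S : collapsing_scheme K) (B : forall n, set (K n)) : Prop :=
  EquivariantScheme {
  equiv_cells : forall n (m : M) (x : K n), cells x <-> cells (sact m x);
  equiv_types : forall n (m : M) (x : K n), cells x ->
    [/\ essential S x <-> essential S (sact m x),
        redundant S x <-> redundant S (sact m x) &
        collapsible S x <-> collapsible S (sact m x)];
  equiv_cmap : forall n (m : M) (x : K n), redundant S x ->
    cmap S (sact m x) = sact m (cmap S x);
  basis_sub : forall n, B n `<=` @essential K S n `|` @redundant K S n `|` @collapsible K S n;
  basis_cells : forall n, free_with_basis (@sact M K n) (@cells K n) (B n);
  basis_ess : forall n,
    free_with_basis (@sact M K n) (@essential K S n) (@essential K S n `&` B n);
  basis_red : forall n,
    free_with_basis (@sact M K n) (@redundant K S n) (@redundant K S n `&` B n);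
  basis_col : forall n,
    free_with_basis (@sact M K n) (@collapsible K S n) (@collapsible K S n `&` B n);
  basis_matched : forall n (x : K n), redundant S x ->
    ((@redundant K S n `&` B n) x <-> (@collapsible K S n.+1 `&` B n.+1) (cmap S x));
  equiv_height : forall n (m : M) (x : K n), redundant S x ->
    height S x = height S (sact m x)
}.

Record mspace (M : monoidType) := MSpace {
  mspace_sort :> topologicalType;
  msact : M -> mspace_sort -> mspace_sort;
  msact1 : forall x, msact 1%g x = x;
  msactM : forall (a b : M) x, msact (a * b)%g x = msact a (msact b x);
  msact_continuous :
    continuous (fun p : discrete_topology M * mspace_sort => msact p.1 p.2)
}.

Definition is_mmap (M : monoidType) (X Y : mspace M) (f : X -> Y) : Prop :=
  continuous f /\ forall m x, f (msact m x) = msact m (f x).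

Definition is_miso (M : monoidType) (X Y : mspace M) (f : X -> Y) : Prop :=
  is_mmap f /\ exists g : Y -> X, [/\ is_mmap g, cancel f g & cancel g f].

Lemma discrete_action_continuous (M : choiceType) (T : topologicalType)
    (act : M -> T -> T) :
  (forall m, continuous (act m)) ->
  continuous (fun p : discrete_topology M * T => act p.1 p.2).
Proof.
move=> act_cont [m x] U /= Ux.
exists ([set m], act m @^-1` U) => /=.
  by split; [exact: discrete_set1 | exact: act_cont].
by move=> [a b] [/= -> ?].
Qed.

Section discrete_mspace.
Variables (M : monoidType) (P : mset M) (T : topologicalType).

Let prod_act (m : M) (p : discrete_topology P * T) : discrete_topology P * T :=
  (mact m p.1, p.2).

Let prod_act1 p : prod_act 1%g p = p.
Proof. by case: p => p t; rewrite /prod_act mact1. Qed.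

Let prod_actM (a b : M) p :
  prod_act (a * b)%g p = prod_act a (prod_act b p).
Proof. by rewrite /prod_act mactM. Qed.

Let prod_act_continuous :
  continuous (fun p : discrete_topology M * (discrete_topology P * T)%type =>
                prod_act p.1 p.2).
Proof.
apply: (@discrete_action_continuous M (discrete_topology P * T)%type prod_act).
move=> m [p t] U [[V W] /= [Vp Wt] VWU].
exists ([set p], W); first by split => //; exact: discrete_set1.
by move=> [q s] [/= -> Ws]; apply: VWU; split => //; exact: (nbhs_singleton Vp).
Qed.

(* P x T with P discrete and trivial action on T. *)
Definition prod_mspace : mspace M :=
  MSpace prod_act1 prod_actM prod_act_continuous.

Let disc_act_continuous :
  continuous (fun p : discrete_topology M * discrete_topology P =>
                mact p.1 p.2 : discrete_topology P).
Proof.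
apply: (@discrete_action_continuous M (discrete_topology P) (@mact M P)).
move=> m p U /nbhs_singleton Up.
apply: (@filterS _ (nbhs (p : discrete_topology P)) _ [set p]).
  by move=> q ->.
exact: discrete_set1.
Qed.

Definition discrete_mspace : mspace M :=
  @MSpace M (discrete_topology P) (@mact M P) (@mact1 M P) (@mactM M P)
    disc_act_continuous.

End discrete_mspace.

Definition unit_interval (R : realType) : set R := [set` `[0, 1]].
Arguments unit_interval R : clear implicits.

Section mhomotopy.
Variables (R : realType) (M : monoidType).

Definition mhomotopic (X Y : mspace M) (f g : X -> Y) : Prop :=
  exists H : X * unit_interval R -> Y,
    [/\ continuous H,
        forall m x t, H (msact m x, t) = msact m (H (x, t)),
        forall x t, \val t = 0 -> H (x, t) = f x &
        forall x t, \val t = 1 -> H (x, t) = g x].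

Definition mhomotopy_equivalent (X Y : mspace M) : Prop :=
  exists (f : X -> Y) (g : Y -> X),
    [/\ is_mmap f, is_mmap g,
        mhomotopic (g \o f) idfun & mhomotopic (f \o g) idfun].

End mhomotopy.

Definition is_pushout (M : monoidType) (A B C D : mspace M)
    (f : A -> B) (g : A -> C) (h : B -> D) (k : C -> D) : Prop :=
  [/\ is_mmap f, is_mmap g, is_mmap h, is_mmap k &
      h \o f = k \o g /\
      forall (Z : mspace M) (u : B -> Z) (v : C -> Z),
        is_mmap u -> is_mmap v -> u \o f = v \o g ->
        exists! w : D -> Z, [/\ is_mmap w, w \o h = u & w \o k = v]].

Definition is_seq_colimit (M : monoidType) (X_ : nat -> mspace M)
    (incl : forall n, X_ n -> X_ n.+1) (X : mspace M)
    (inj : forall n, X_ n -> X) : Prop :=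
  [/\ forall n, is_mmap (incl n), forall n, is_mmap (inj n),
      forall n, inj n.+1 \o incl n = inj n &
      forall (Z : mspace M) (u : forall n, X_ n -> Z),
        (forall n, is_mmap (u n)) -> (forall n, u n.+1 \o incl n = u n) ->
        exists! w : X -> Z, is_mmap w /\ forall n, w \o inj n = u n].

(* The Euclidean ball B^n and sphere S^(n-1) in R^n; the norm of the library on
   row vectors is the sup norm, hence the explicit sums of squares. *)
Definition unit_disk (R : realType) (n : nat) : set 'rV[R]_n :=
  [set u | \sum_(k < n) u ord0 k ^+ 2 <= 1].
Arguments unit_disk R n : clear implicits.

Definition unit_sphere (R : realType) (n : nat) : set 'rV[R]_n :=
  [set u | \sum_(k < n) u ord0 k ^+ 2 = 1].
Arguments unit_sphere R n : clear implicits.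

Lemma unit_sphere_sub R n : unit_sphere R n `<=` unit_disk R n.
Proof. by move=> u; rewrite /unit_sphere /unit_disk /= => ->. Qed.

Definition sphere_incl R n (s : unit_sphere R n) : unit_disk R n :=
  SigSub (mem_set (unit_sphere_sub (set_valP s))).

Section free_mcw.
Variables (R : realType) (M : monoidType).

(* [cw_skel n] is X_n and [cw_cells n] is P_n. *)
Record free_mcw := FreeMCW {
  cw_space :> mspace M;
  cw_cells : nat -> mset M;
  cw_cells_free : forall n, is_free (@mact M (cw_cells n)) [set: cw_cells n];
  cw_skel : nat -> mspace M;
  cw_zero : discrete_mspace (cw_cells 0) -> cw_skel 0;
  cw_zero_iso : is_miso cw_zero;
  cw_incl : forall n, cw_skel n -> cw_skel n.+1;
  cw_attach : forall n,
    prod_mspace (cw_cells n.+1) (unit_sphere R n.+1) -> cw_skel n;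
  cw_char : forall n,
    prod_mspace (cw_cells n.+1) (unit_disk R n.+1) -> cw_skel n.+1;
  cw_pushout : forall n,
    @is_pushout M
      (prod_mspace (cw_cells n.+1) (unit_sphere R n.+1)) (cw_skel n)
      (prod_mspace (cw_cells n.+1) (unit_disk R n.+1)) (cw_skel n.+1)
      (@cw_attach n) (fun p => (p.1, sphere_incl p.2))
      (@cw_incl n) (@cw_char n);
  cw_inj : forall n, cw_skel n -> cw_space;
  cw_colimit : is_seq_colimit cw_incl cw_inj
}.

End free_mcw.

Definition std_simplex (R : realType) (n : nat) : set 'rV[R]_n.+1 :=
  [set u | (forall k, 0 <= u ord0 k) /\ \sum_k u ord0 k = 1].
Arguments std_simplex R n : clear implicits.

Section simplex_map.
Variable R : realType.

(* The affine map sending the vertex l of the standard m-simplex to the vertex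
   f l of the standard n-simplex. *)
Definition simplex_push m n (f : 'I_m.+1 -> 'I_n.+1) (u : 'rV[R]_m.+1) :
  'rV[R]_n.+1 := \row_k \sum_(l | f l == k) u ord0 l.

Lemma simplex_push_subproof m n (f : 'I_m.+1 -> 'I_n.+1)
    (u : std_simplex R m) : simplex_push f (\val u) \in std_simplex R n.
Proof.
have [u0 u1] := set_valP u; apply: mem_set; split.
  by move=> k; rewrite mxE sumr_ge0.
rewrite -u1 (partition_big f xpredT)//=.
by apply: eq_bigr => k _; rewrite mxE.
Qed.

Definition simplex_map m n (f : 'I_m.+1 -> 'I_n.+1) (u : std_simplex R m) :
  std_simplex R n := SigSub (simplex_push_subproof f u).

Definition coface n (j : 'I_n.+2) : std_simplex R n -> std_simplex R n.+1 :=
  simplex_map (lift j).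

Definition codegen n (j : 'I_n.+1) : std_simplex R n.+1 -> std_simplex R n :=
  simplex_map (fun l : 'I_n.+2 => inord (unbump j l)).

End simplex_map.

Section realisation.
Variables (R : realType) (K : sset).

Definition simplex_sum : topologicalType :=
  {n : nat & (discrete_topology (K n) * std_simplex R n)%type}.

Definition simplex_point n (x : K n) (u : std_simplex R n) : simplex_sum :=
  existT _ n (x : discrete_topology (K n), u).

Inductive glue_step : simplex_sum -> simplex_sum -> Prop :=
| glue_face n (j : 'I_n.+2) (x : K n.+1) (u : std_simplex R n) :
    glue_step (simplex_point (face j x) u) (simplex_point x (coface j u))
| glue_degen n (j : 'I_n.+1) (x : K n) (u : std_simplex R n.+1) :
    glue_step (simplex_point (degen j x) u) (simplex_point x (codegen j u)).

Definition glue (a b : simplex_sum) : bool :=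
  `[< clos_refl_sym_trans _ glue_step a b >].

Lemma glue_refl : reflexive glue.
Proof. by move=> a; apply/asboolP; exact: rst_refl. Qed.

Lemma glue_sym : symmetric glue.
Proof. by move=> a b; apply/asboolP/asboolP => ?; exact: rst_sym. Qed.

Lemma glue_trans : transitive glue.
Proof.
move=> b a c /asboolP ab /asboolP bc; apply/asboolP.
exact: rst_trans ab bc.
Qed.

Canonical glue_equiv := EquivRel glue glue_refl glue_sym glue_trans.

Definition realisation : topologicalType :=
  quotient_topology {eq_quot glue_equiv}.

Definition realisation_pi : simplex_sum -> realisation :=
  \pi_{eq_quot glue_equiv}.

End realisation.

Section realisation_action.
Variables (R : realType) (M : monoidType) (K : rigid_msset M).

Definition simplex_sum_act (m : M) (a : simplex_sum R K) : simplex_sum R K :=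
  simplex_point (sact m (projT2 a).1) (projT2 a).2.

Definition realisation_act (m : M) (a : realisation R K) : realisation R K :=
  realisation_pi (simplex_sum_act m (repr (a : {eq_quot glue_equiv R K}))).

Lemma simplex_sum_act_glue (m : M) (a b : simplex_sum R K) :
  glue a b -> glue (simplex_sum_act m a) (simplex_sum_act m b).
Proof.
move=> /asboolP ab; apply/asboolP.
elim: ab => [_ _ [] n j x u|x|x y _|x y z _ xy _ yz].
- apply: rst_step; rewrite /simplex_sum_act /= sact_face.
  exact: glue_face.
- apply: rst_step; rewrite /simplex_sum_act /= sact_degen.
  exact: glue_degen.
- exact: rst_refl.
- exact: rst_sym.
- exact: rst_trans xy yz.
Qed.

Lemma realisation_actE (m : M) n (x : K n) (u : std_simplex R n) :
  realisation_act m (realisation_pi (simplex_point x u))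
  = realisation_pi (simplex_point (sact m x) u).
Proof.
apply/eqquotP.
apply: (@simplex_sum_act_glue m _ (simplex_point x u)).
by apply/(@eqquotP _ (glue_equiv R K)); exact: reprK.
Qed.

Lemma realisation_act_pi (m : M) (a : simplex_sum R K) :
  realisation_act m (realisation_pi a) = realisation_pi (simplex_sum_act m a).
Proof. by case: a => n [x u]; exact: realisation_actE. Qed.

Lemma realisation_piW (P : realisation R K -> Prop) :
  (forall a, P (realisation_pi a)) -> forall q, P q.
Proof. by move=> Ppi q; rewrite -[q](@reprK _ {eq_quot glue_equiv R K}); exact: Ppi. Qed.

Lemma realisation_act1 q : realisation_act 1%g q = q.
Proof.
elim/realisation_piW: q => -[n [x u]].
by rewrite realisation_act_pi /simplex_sum_act sact1.
Qed.

Lemma realisation_actM (a b : M) q :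
  realisation_act (a * b)%g q = realisation_act a (realisation_act b q).
Proof.
elim/realisation_piW: q => -[n [x u]].
by rewrite !realisation_act_pi /simplex_sum_act sactM.
Qed.

Lemma simplex_sum_act_continuous m : continuous (simplex_sum_act m).
Proof.
apply: (@sigT_continuous _ _ _
  (fun n (p : discrete_topology (K n) * std_simplex R n) =>
     simplex_point (sact m p.1) p.2)) => n [x u] U [[V W] /= [Vx Wu] VWU].
exists ([set x], W); first by split => //; exact: discrete_set1.
by move=> [y v] [/= -> Wv]; apply: VWU; split => //; exact: (nbhs_singleton Vx).
Qed.

Lemma realisation_act_continuous :
  continuous (fun p : discrete_topology M * realisation R K =>
                realisation_act p.1 p.2).
Proof.
apply: (@discrete_action_continuous M (realisation R K) realisation_act) => m.
apply/quotient_continuous.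
rewrite [X in continuous X](_ : _ = @realisation_pi R K \o simplex_sum_act m).
  move=> a; apply: continuous_comp; first exact: simplex_sum_act_continuous.
  exact: pi_continuous.
by apply/funext => a; exact: realisation_act_pi.
Qed.

Definition realisation_mspace : mspace M :=
  MSpace realisation_act1 realisation_actM realisation_act_continuous.

End realisation_action.

(* Main.v *)
From HB Require Import structures.
Require Import Defs.
From Stdlib Require Import Relation_Operators.
From mathcomp Require Import all_boot all_order all_algebra.
From mathcomp Require Import generic_quotient zify lra ring.
From mathcomp Require Import all_classical all_reals topology normedtype realfun.

Set Implicit Arguments.
Unset Strict Implicit.
Unset Printing Implicit Defensive.

Import Order.TTheory GRing.Theory Num.Theory.
Import numFieldNormedType.Exports.
Local Open Scope classical_set_scope.
Local Open Scope quotient_scope.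
Local Open Scope ring_scope.

(** A collapsible cell [c t] can be pushed away from its free face [t] onto its
    other faces, which form a horn.  Doing this again and again ends after
    finitely many steps, as redundant cells have no infinite descending
    chain, and gives a map [collapse] from |K| onto the union of the open
    essential cells.  The complex [Y] is that union, with the
    finest topology that makes the maps [collapse \o chi e] continuous, [e] an
    essential cell; [chi e] is the characteristic map of [e].  As each [Y_n] has
    the corresponding topology, the pushout and colimit properties reduce to set
    theory, and [collapse : |K| -> Y] is continuous because it is so on each
    simplex, by induction along the scheme.

    The homotopy equivalence comes from a single homotopy [flow] of |K|, starting
    at the identity, such that
      flow p 1 = flow (collapse p) 1                      ([flow1_collapse]),
      collapse (flow p t) = collapse (flow (collapse p) t)  ([collapse_flow]).
    By the first equation the end of the flow factors as [g \o collapse] with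
    [g : Y -> |K|], so [g \o collapse] is homotopic to the identity; by the second
    one [collapse \o flow] passes to [Y], where it is a homotopy from the identity
    to [collapse \o g].  So there is no step that glues homotopy equivalences of
    skeleta or passes to a limit of them.

    The flow does the collapse of the redundant [n]-cells and their partners in
    the time slot from 2^-(n+1) to 2^-n; high dimensions come first.  A simplex of
    dimension [n] does not move before time 2^-(n+1) ([flow_early]), so on each
    simplex only finitely many slots matter, and this gives continuity.  Inside
    its slot a point moves along a fibre of [collapse] ([collapse_flow_early]),
    and after it the point agrees with its image in the horn
    ([flow_late_redundant]); these two facts yield the two equations.  An
    essential [n]-cell starts to move at time 2^-n, dragged by its boundary: this
    is an explicit homotopy extension.

    Both [collapse] and [flow] are defined by recursion on the points of |K|.
    This rests on the fact that each point lies in the interior of exactly one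
    cell with exactly one system of barycentric coordinates ([chi_cell_inj]), and
    on the induction principle [simplex_ind], which packages the axioms of a
    collapsing scheme.  The action of [M] commutes with everything since it
    preserves the scheme, including the index of the free face ([imap_act]). *)

(** * Barycentric coordinates and cosimplicial maps *)
Section cosimplicial.
Variable R : realType.
Local Notation Delta := (std_simplex R).

Definition bary n (u : Delta n) (k : 'I_n.+1) : R := (\val u) ord0 k.

Lemma bary_ge0 n (u : Delta n) k : 0 <= bary u k.
Proof. by have [+ _] := set_valP u; apply. Qed.

Lemma bary_sum n (u : Delta n) : \sum_k bary u k = 1.
Proof. by have [_] := set_valP u. Qed.

Lemma bary0 (u : Delta 0) k : bary u k = 1.
Proof. by rewrite -(bary_sum u) big_ord1 (ord1 k). Qed.

Lemma bary_inj n (u v : Delta n) : (forall k, bary u k = bary v k) -> u = v.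
Proof.
by move=> uv; apply/val_inj/rowP => k; exact: uv.
Qed.

Lemma simplex_of_subproof n (w : 'I_n.+1 -> R) :
  (forall k, 0 <= w k) -> \sum_k w k = 1 -> (\row_k w k) \in Delta n.
Proof.
move=> w0 w1; apply/mem_set; split=> [k|]; first by rewrite mxE.
by rewrite -[RHS]w1; apply: eq_bigr => k _; rewrite mxE.
Qed.

Definition simplex_of n (w : 'I_n.+1 -> R) (w0 : forall k, 0 <= w k)
    (w1 : \sum_k w k = 1) : Delta n :=
  SigSub (simplex_of_subproof w0 w1).

Lemma bary_simplex_of n (w : 'I_n.+1 -> R) w0 w1 k :
  bary (@simplex_of n w w0 w1) k = w k.
Proof. by rewrite /bary /= mxE. Qed.

Lemma bary_map m n (f : 'I_m.+1 -> 'I_n.+1) (u : Delta m) k :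
  bary (simplex_map f u) k = \sum_(l | f l == k) bary u l.
Proof. by rewrite /bary /= mxE. Qed.

Lemma simplex_map_comp l m n (f : 'I_m.+1 -> 'I_n.+1) (g : 'I_l.+1 -> 'I_m.+1)
    (u : Delta l) : simplex_map f (simplex_map g u) = simplex_map (f \o g) u.
Proof.
apply: bary_inj => k; rewrite !bary_map.
rewrite (partition_big g (fun j => f j == k)) //=.
apply: eq_bigr => j fj; rewrite bary_map; apply: eq_bigl => i.
by case: eqP => [->|]; rewrite ?andbF ?andbT ?fj.
Qed.

Lemma eq_simplex_map m n (f g : 'I_m.+1 -> 'I_n.+1) (u : Delta m) :
  f =1 g -> simplex_map f u = simplex_map g u.
Proof. by move=> /funext ->. Qed.

Lemma simplex_map_id n (f : 'I_n.+1 -> 'I_n.+1) (u : Delta n) :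
  f =1 id -> simplex_map f u = u.
Proof.
move=> fid; apply: bary_inj => k; rewrite bary_map (eq_bigl (pred1 k)) => [|l].
  by rewrite big_pred1_eq.
by rewrite fid.
Qed.

Lemma bary_coface_lift n (j : 'I_n.+2) (u : Delta n) k :
  bary (coface j u) (lift j k) = bary u k.
Proof.
rewrite bary_map (big_pred1 k)// => l /=.
by rewrite (inj_eq (@lift_inj _ j)).
Qed.

Lemma bary_coface_eq n (j : 'I_n.+2) (u : Delta n) : bary (coface j u) j = 0.
Proof.
by rewrite bary_map big1// => l /eqP ljj; have := neq_lift j l; rewrite ljj eqxx.
Qed.

Lemma coface_inj n (j : 'I_n.+2) : injective (@coface R n j).
Proof.
move=> u v uv; apply: bary_inj => k.
by rewrite -(bary_coface_lift j u) uv bary_coface_lift.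
Qed.

Lemma cofaceP n (u : Delta n.+1) j : bary u j = 0 -> exists v, u = coface j v.
Proof.
move=> uj; have s1 : \sum_k bary u (lift j k) = 1.
  by rewrite -(bary_sum u) [RHS](bigD1_ord j)//= uj add0r.
exists (simplex_of (fun k => bary_ge0 u (lift j k)) s1); apply: bary_inj => k.
have [l ->|->] := unliftP j k; last by rewrite uj bary_coface_eq.
by rewrite bary_coface_lift bary_simplex_of.
Qed.
End cosimplicial.

Lemma codegenE n (j : 'I_n.+1) (l : 'I_n.+2) :
  nat_of_ord (inord (unbump j l) : 'I_n.+1) = unbump j l.
Proof.
rewrite inordK//; have := ltn_ord j; have := ltn_ord l.
by rewrite /unbump; case: ltnP => /=; lia.
Qed.

Section cosimplicial_identities.
Variable R : realType.
Local Notation Delta := (std_simplex R).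

Ltac ord_arith := move=> l; apply: ord_inj; rewrite /comp ?codegenE /= ?codegenE
  /bump /unbump /=; repeat (case: leqP => ? /=); lia.

Lemma coface_coface n (i j : 'I_n.+2) (v : Delta n) : (i <= j)%N ->
  coface (lift ord0 j) (coface i v) = coface (widen_ord (leqnSn _) i) (coface j v).
Proof.
by move=> ij; rewrite /coface !simplex_map_comp; apply: eq_simplex_map; ord_arith.
Qed.

Lemma codegen_coface_eq n (j : 'I_n.+1) (v : Delta n) :
  codegen j (coface (widen_ord (leqnSn _) j) v) = v.
Proof.
by rewrite /coface /codegen simplex_map_comp; apply: simplex_map_id; ord_arith.
Qed.

Lemma codegen_coface_eqS n (j : 'I_n.+1) (v : Delta n) :
  codegen j (coface (lift ord0 j) v) = v.
Proof.
by rewrite /coface /codegen simplex_map_comp; apply: simplex_map_id; ord_arith.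
Qed.

Lemma codegen_coface_lt n (i : 'I_n.+2) (j : 'I_n.+1) (v : Delta n.+1) :
  (i <= j)%N ->
  codegen (lift ord0 j) (coface (widen_ord (leqnSn _) i) v)
  = coface i (codegen j v).
Proof.
move=> ij; rewrite /coface /codegen !simplex_map_comp.
by apply: eq_simplex_map; ord_arith.
Qed.

Lemma codegen_coface_gt n (i : 'I_n.+2) (j : 'I_n.+1) (v : Delta n.+1) :
  (j < i)%N ->
  codegen (widen_ord (leqnSn _) j) (coface (lift ord0 i) v)
  = coface i (codegen j v).
Proof.
move=> ij; rewrite /coface /codegen !simplex_map_comp.
by apply: eq_simplex_map; ord_arith.
Qed.

Lemma codegen_codegen n (i j : 'I_n.+1) (v : Delta n.+2) : (i <= j)%N ->
  codegen j (codegen (widen_ord (leqnSn _) i) v)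
  = codegen i (codegen (lift ord0 j) v).
Proof.
move=> ij; rewrite /codegen !simplex_map_comp.
by apply: eq_simplex_map; ord_arith.
Qed.

End cosimplicial_identities.

Lemma ord_lt_widen n (i j : 'I_n.+1) : (i < j)%N ->
  exists i' : 'I_n, i = widen_ord (leqnSn _) i'.
Proof.
move=> ij; have h : (i < n)%N by have := ltn_ord j; lia.
by exists (Ordinal h); apply/val_inj.
Qed.

Lemma ord_gt_lift n (i j : 'I_n.+1) : (i < j)%N ->
  exists j' : 'I_n, j = lift ord0 j'.
Proof.
move=> ij; have h : (j.-1 < n)%N by have := ltn_ord j; lia.
by exists (Ordinal h); apply/val_inj; rewrite /= /bump /=; lia.
Qed.

Definition inner (R : realType) n (J : pred 'I_n.+1) (u : std_simplex R n) :=
  forall k, J k -> 0 < bary u k.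

Definition bdry (R : realType) n (J : pred 'I_n.+1) (u : std_simplex R n) :=
  exists2 k, J k & bary u k = 0.

Notation inside := (inner xpredT).

(** * Normal forms of points of the realisation *)
Section normal_form.
Variables (R : realType) (K : sset).
Local Notation Delta := (std_simplex R).
Local Notation sum := (simplex_sum R K).

Definition chi n (x : K n) (u : Delta n) : realisation R K :=
  realisation_pi (simplex_point x u).

Lemma chi_surj p : exists n (x : K n) (u : Delta n), p = chi x u.
Proof.
rewrite -[p](@reprK _ {eq_quot glue_equiv R K}); case: (repr _) => n [x u].
by exists n, x, u.
Qed.

(** One reduction step on a simplex with a point: pass to a face if the point lies
    on it, or strip a degeneracy.  Each step lowers the dimension by one, so
    uniqueness of normal forms follows from a one-step diamond property, with no
    appeal to the factorisation of maps in the simplex category. *)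
Definition reduces (a b : sum) : Prop :=
  exists n (x : K n.+1) (u : Delta n.+1), a = simplex_point x u /\
   ((exists j v, u = coface j v /\ b = simplex_point (face j x) v) \/
    (exists j y, x = degen j y /\ b = simplex_point y (codegen j u))).

Lemma simplex_point_inj n (x y : K n) (u v : Delta n) :
  simplex_point x u = simplex_point y v -> x = y /\ u = v.
Proof.
by move=> xuyv; have [-> ->] := Eqdep_dec.inj_pair2_eq_dec _ PeanoNat.Nat.eq_dec
  (fun n => discrete_topology (K n) * Delta n)%type _ _ _ xuyv.
Qed.

Lemma reduces_face n (x : K n.+1) j v :
  reduces (simplex_point x (coface j v)) (simplex_point (face j x) v).
Proof. by exists n, x, (coface j v); split=> //; left; exists j, v. Qed.

Lemma reduces_degen n (y : K n) j u :
  reduces (simplex_point (degen j y) u) (simplex_point y (codegen j u)).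
Proof. by exists n, (degen j y), u; split=> //; right; exists j, y. Qed.

Lemma reduces_dim (a b : sum) : reduces a b -> projT1 a = (projT1 b).+1.
Proof. by move=> [n [x [u [-> [[j [v [_ ->]]]|[j [y [_ ->]]]]]]]]. Qed.

Definition joinable (b c : sum) := b = c \/ exists2 d, reduces b d & reduces c d.

Lemma joinable_sym b c : joinable b c -> joinable c b.
Proof. by case=> [->|[d ? ?]]; [left|right; exists d]. Qed.

(** Two faces of the point: the two cofaces commute past each other, as the
    point lies on a common face of codimension two. *)
Lemma joinable_ff n (x : K n.+1) (j j' : 'I_n.+2) (v v' : Delta n) :
  (j < j')%N ->
  coface j v = coface j' v' :> Delta n.+1 ->
  joinable (simplex_point (face j x) v) (simplex_point (face j' x) v').
Proof.
move=> jj'; have [i def_i] := ord_lt_widen jj'; have [k def_k] := ord_gt_lift jj'.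
subst j j'; have ik : (i <= k)%N by move: jj'; rewrite /= /bump /=; lia.
move=> vv'; have v'i : bary v' i = 0.
  rewrite -(bary_coface_lift (lift ord0 k)) -vv'.
  rewrite (_ : lift (lift ord0 k) i = widen_ord (leqnSn _) i) ?bary_coface_eq//.
  by apply/val_inj; rewrite /= /bump /=; lia.
case: n => [|n] in x v v' i k jj' ik vv' v'i *.
  by move/eqP: v'i; rewrite bary0 oner_eq0.
have [w def_v'] := cofaceP v'i; rewrite {}def_v' in vv' *.
move: vv'; rewrite coface_coface// => /coface_inj ->.
right; exists (simplex_point (face i (face (lift ord0 k) x)) w).
  by rewrite face_face//; exact: reduces_face.
exact: reduces_face.
Qed.

(** A face against a degeneracy: either they cancel, and the two reducts are
    equal, or they commute. *)
Lemma joinable_fd n (y : K n) (i : 'I_n.+1) (j : 'I_n.+2) (v : Delta n) :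
  joinable (simplex_point (face j (degen i y)) v)
           (simplex_point y (codegen i (coface j v))).
Proof.
have [ji|ij|ij] := ltngtP j i.
- case: n => [|n] in y i j v ji *; first by move: ji; rewrite (ord1 i).
  have [j' def_j] : exists j' : 'I_n.+2, j = widen_ord (leqnSn _) j'.
    by apply: (@ord_lt_widen _ _ (widen_ord (leqnSn _) i)).
  have [i' def_i] : exists i' : 'I_n.+1, i = lift ord0 i'.
    by apply: (@ord_gt_lift _ ord0); rewrite /=; lia.
  subst i j; have ij' : (j' <= i')%N by move: ji; rewrite /= /bump /=; lia.
  rewrite face_degen_lt// codegen_coface_lt//.
  right; exists (simplex_point (face j' y) (codegen i' v)).
    exact: reduces_degen.
  exact: reduces_face.
- have [j' def_j] : exists j' : 'I_n.+1, j = lift ord0 j'.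
    by apply: (@ord_gt_lift _ ord0); rewrite /=; lia.
  subst j; move: ij; rewrite /= /bump /= add1n ltnS leq_eqVlt => /orP[/eqP ij|ij].
    have -> : j' = i by exact/val_inj.
    by rewrite face_degen_eqS codegen_coface_eqS; left.
  case: n => [|n] in y i j' v ij *; first by move: ij; rewrite (ord1 j').
  have [i' def_i] := ord_lt_widen ij; subst i.
  rewrite face_degen_gt// codegen_coface_gt//.
  right; exists (simplex_point (face j' y) (codegen i' v)).
    exact: reduces_degen.
  exact: reduces_face.
- have -> : j = widen_ord (leqnSn _) i by exact/val_inj.
  by rewrite face_degen_eq codegen_coface_eq; left.
Qed.

(** Two degeneracies of the simplex: applying faces to the equation
    [degen i y = degen j y'] shows that [y] and [y'] are themselves degeneracies of
    one simplex, a face of [y']. *)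
Lemma joinable_dd n (y y' : K n) (i j : 'I_n.+1) (u : Delta n.+1) :
  (i < j)%N ->
  degen i y = degen j y' ->
  joinable (simplex_point y (codegen i u)) (simplex_point y' (codegen j u)).
Proof.
move=> ij; have [i' def_i] := ord_lt_widen ij; have [j' def_j] := ord_gt_lift ij.
subst i j; case: n => [|n] in y y' u i' j' ij *; first by case: i' ij.
have ij' : (i' <= j')%N by move: ij; rewrite /= /bump /=; lia.
move=> yy'.
have def_y : y = degen j' (face (widen_ord (leqnSn _) i') y').
  have := congr1 (face (widen_ord (leqnSn _) (widen_ord (leqnSn _) i'))) yy'.
  by rewrite face_degen_eq face_degen_lt.
have def_y' : y' = degen i' (face (widen_ord (leqnSn _) i') y').
  have := congr1 (face (lift ord0 (lift ord0 j'))) yy'.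
  rewrite face_degen_eqS {1}def_y face_degen_gt; last first.
    by rewrite /= /bump /=; lia.
  by rewrite face_degen_eqS.
right; exists (simplex_point (face (widen_ord (leqnSn _) i') y')
   (codegen j' (codegen (widen_ord (leqnSn _) i') u))).
  rewrite [in X in reduces X]def_y; exact: reduces_degen.
rewrite codegen_codegen// [in X in reduces X]def_y'; exact: reduces_degen.
Qed.

Lemma reduces_diamond a b c : reduces a b -> reduces a c -> joinable b c.
Proof.
move=> [n [x [u [-> ab]]]] [n' [x' [u' [xux'u' ac]]]].
have nn' : n' = n by have := congr1 (@projT1 _ _) xux'u' => -[].
subst n'; have [? ?] := simplex_point_inj xux'u'; subst x' u'.
have fd j v i y : u = coface j v -> x = degen i y ->
    joinable (simplex_point (face j x) v) (simplex_point y (codegen i u)).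
  by move=> -> ->; exact: joinable_fd.
case: ab => [[j [v [ujv ->]]]|[j [y [xjy ->]]]];
  case: ac => [[i [w [uiw ->]]]|[i [z [xiz ->]]]].
- have [ji|ij|/val_inj ij] := ltngtP j i.
  + by apply: joinable_ff => //; rewrite -ujv.
  + by apply/joinable_sym/joinable_ff => //; rewrite -ujv.
  + by subst i; move: uiw; rewrite ujv => /coface_inj ->; left.
- exact: fd.
- exact/joinable_sym/fd.
- have [ji|ij|/val_inj ij] := ltngtP j i.
  + by apply: joinable_dd => //; rewrite -xjy.
  + by apply/joinable_sym/joinable_dd => //; rewrite -xjy.
  + subst i; left; congr simplex_point.
    by rewrite -(face_degen_eq j y) -xjy xiz face_degen_eq.
Qed.

Definition normal (a : sum) : Prop := ~ exists b, reduces a b.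

Local Notation reduces_to := (clos_refl_trans_1n _ reduces).

Lemma normalize a : exists2 b, reduces_to a b & normal b.
Proof.
have [n] := ubnP (projT1 a); elim: n a => // n IH a an.
have [[b ab]|na] := pselect (exists b, reduces a b).
  have [|c bc nc] := IH b; first by move: an; rewrite (reduces_dim ab).
  by exists c => //; apply: rt1n_trans bc.
by exists a => //; exact: rt1n_refl.
Qed.

(** The induction of Newman's lemma on the dimension; a one-step diamond
    suffices because normal forms of the common reduct exist. *)
Lemma normal_unique a b c : reduces_to a b -> normal b ->
  reduces_to a c -> normal c -> b = c.
Proof.
have [n] := ubnP (projT1 a); elim: n a b c => // n IH a b c an.
case=> [na|b' {}b ab' b'b nb]; case=> [nc|c' {}c ac' c'c nc] //.
- by case: na; exists c'.
- by case: nc; exists b'.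
have lt_dim d : reduces a d -> (projT1 d < n)%N.
  by move=> ad; move: an; rewrite (reduces_dim ad).
have [b'c'|[d b'd c'd]] := reduces_diamond ab' ac'.
  by subst c'; exact: (IH _ _ _ (lt_dim _ ab') b'b nb c'c nc).
have [e de ne] := normalize d.
transitivity e.
  by apply: (IH _ _ _ (lt_dim _ ab') b'b nb) => //; exact: rt1n_trans de.
by symmetry; apply: (IH _ _ _ (lt_dim _ ac') c'c nc) => //; exact: rt1n_trans de.
Qed.

Lemma glue_normal a b c d : clos_refl_sym_trans _ (@glue_step R K) a b ->
  reduces_to a c -> normal c -> reduces_to b d -> normal d -> c = d.
Proof.
move=> ab; elim: ab c d => {a b}.
- move=> _ _ [n j x u|n j x u] c d ac nc bd nd.
  + by apply: (normal_unique _ nc bd nd); apply: rt1n_trans ac; exact: reduces_face.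
  + by apply: (normal_unique ac nc _ nd); apply: rt1n_trans bd; exact: reduces_degen.
- by move=> a c d ac nc ad nd; exact: (normal_unique ac nc ad nd).
- by move=> a b _ IH c d bc nc ad nd; symmetry; exact: IH.
- move=> a b c _ ab _ bc a' c' aa' na' cc' nc'.
  have [b' bb' nb'] := normalize b.
  by transitivity b'; [exact: ab | exact: bc].
Qed.

Lemma normalP n (x : K n) (u : Delta n) :
  normal (simplex_point x u) <-> cells x /\ inside u.
Proof.
split=> [nxu|[xcell uint] [b [m [y [v [def_n redb]]]]]].
  split=> [|k _]; last first.
    rewrite lt_neqAle bary_ge0 andbT; apply/eqP => /esym uk; apply: nxu.
    case: n => [|n] in x u k uk *.
      by move/eqP: uk; rewrite bary0 oner_eq0.
    have [v ->] := cofaceP uk.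
    by exists (simplex_point (face k x) v); exact: reduces_face.
  case: n => [|n] in x u nxu *; first by [].
  move=> [j [y def_x]]; apply: nxu; exists (simplex_point y (codegen j u)).
  by rewrite def_x; exact: reduces_degen.
have mn : n = m.+1 by exact: (congr1 (@projT1 _ _) def_n).
subst n; have [? ?] := simplex_point_inj def_n; subst y v.
case: redb => [[j [v [ujv _]]]|[j [y [xjy _]]]].
  by have := uint j isT; rewrite ujv bary_coface_eq ltxx.
by apply: xcell; exists j, y.
Qed.

Lemma chi_face n (x : K n.+1) j (u : Delta n) :
  chi (face j x) u = chi x (coface j u).
Proof. by apply/eqquotP/asboolP/rst_step; exact: glue_face. Qed.

Lemma chi_degen n (x : K n) j (u : Delta n.+1) :
  chi (degen j x) u = chi x (codegen j u).
Proof. by apply/eqquotP/asboolP/rst_step; exact: glue_degen. Qed.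

(** Glued simplices with points have the same normal form, and a cell with an
    interior point is already in normal form.  Every function on |K| that is defined
    cell by cell depends on this. *)
Lemma chi_cell_inj m n (x : K m) (y : K n) (u : Delta m) (v : Delta n) :
  cells x -> inside u -> cells y -> inside v ->
  chi x u = chi y v -> simplex_point x u = simplex_point y v.
Proof.
move=> xc ui yc vi /eqquotP /asboolP uv.
by apply: (glue_normal uv); (try exact: rt1n_refl); exact/normalP.
Qed.

End normal_form.

Lemma inner_or_bdry (R : realType) n (J : pred 'I_n.+1) (u : std_simplex R n) :
  inner J u \/ bdry J u.
Proof.
have [[k Jk uk]|nb] := pselect (bdry J u); first by right; exists k.
left=> k Jk; rewrite lt_neqAle bary_ge0 andbT; apply/eqP => uk.
by apply: nb; exists k.
Qed.

(** * Induction and recursion along a collapsing scheme *)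
(** Dependent choice turns the absence of infinite descending sequences, which
    is how a collapsing scheme is axiomatised, into an induction principle. *)
Lemma no_descent_wf (T : Type) (r : T -> T -> Prop) :
  ~ (exists x : nat -> T, forall k, r (x k.+1) (x k)) -> well_founded r.
Proof.
move=> nchain x0; apply: contrapT => nA.
have next (x : {x | ~ Acc r x}) : exists y : {x | ~ Acc r x}, r (sval y) (sval x).
  case: x => x nx /=; apply: contrapT => nex; apply: nx; constructor=> y yx.
  by apply: contrapT => ny; apply: nex; exists (exist _ y ny).
have [f fP] := choice next.
apply: nchain; exists (fun k => sval (iter k f (exist _ x0 nA))) => k /=.
exact: fP.
Qed.

Section scheme.
Variables (R : realType) (K : sset) (S : collapsing_scheme K).
Local Notation Delta := (std_simplex R).
Local Notation X := (realisation R K).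

Lemma prec_wf n : well_founded (@scheme_prec K S n).
Proof. by apply: no_descent_wf; exact: scheme_wf. Qed.

Definition on_faces (P : forall n, K n -> Prop) n : K n -> Prop :=
  match n return K n -> Prop with
  | 0 => fun=> True
  | m.+1 => fun x => forall j, P m (face j x)
  end.

Lemma essential_cell n (x : K n) : essential S x -> cells x.
Proof. by move=> xE; rewrite -(scheme_cover S); left; left. Qed.

Lemma redundant_cell n (x : K n) : redundant S x -> cells x.
Proof. by move=> xE; rewrite -(scheme_cover S); left; right. Qed.

Lemma cmap_collapsible n (x : K n) : redundant S x -> collapsible S (cmap S x).
Proof. by have [+ _ _] := scheme_bij S n; exact. Qed.

Lemma cmap_cell n (x : K n) : redundant S x -> cells (cmap S x).
Proof. by move=> xE; rewrite -(scheme_cover S); right; exact: cmap_collapsible. Qed.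

Lemma collapsibleP n (x : K n.+1) : collapsible S x ->
  exists2 t, redundant S t & cmap S t = x.
Proof. by have [_ _] := scheme_bij S n; exact. Qed.

Lemma cmap_inj n (x y : K n) : redundant S x -> redundant S y ->
  cmap S x = cmap S y -> x = y.
Proof. by have [_ + _] := scheme_bij S n; move=> inj Rx Ry; apply: inj; apply/mem_set. Qed.

Lemma cell_cases n (x : K n) : cells x ->
  [\/ essential S x, redundant S x | collapsible S x].
Proof.
by rewrite -(scheme_cover S) => -[[]|]; [constructor 1|constructor 2|constructor 3].
Qed.

(** Induction along the scheme.  Essential cells are reached from their faces;
    a redundant cell [t] and its partner [cmap S t] are reached together, from the
    horn formed by the other faces of the partner.  It is a strong induction on the
    dimension: a collapsible cell is the partner of a redundant cell one dimension
    lower, and redundant cells of the same dimension are treated by well-founded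
    induction on the precedence relation.  The predicate [A] restricts the
    principle to a skeleton; partners one dimension above are still
    covered. *)
Lemma simplex_ind (A : nat -> Prop) (P : forall n, K n -> Prop) :
  (forall n, A n.+1 -> A n) ->
  (forall n j (y : K n), P n y -> P n.+1 (degen j y)) ->
  (forall n (e : K n), A n -> essential S e -> on_faces P e -> P n e) ->
  (forall n (t : K n), A n -> redundant S t ->
     (forall j, j != imap S t -> P n (face j (cmap S t))) ->
     P n t /\ P n.+1 (cmap S t)) ->
  forall n (x : K n), A n -> P n x.
Proof.
move=> Adown Pdeg PE PR n; have [N] := ubnP n.
elim: N n => // N IH n; rewrite ltnS => nN.
have nonred (x : K n) : A n -> ~ redundant S x -> P n x.
  move=> An xR; have [xc|] := pselect (cells x); last first.
    move=> /contrapT; case: n => [|n] in An x xR nN * => // -[j [y ->]].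
    by apply/Pdeg/IH => //; exact: Adown.
  have [xE|//|xC] := cell_cases xc.
    apply: PE => //; case: n => [|n] in An x xR nN xc xE * => //= j.
    by apply: IH => //; exact: Adown.
  case: n => [|n] in An x xR nN xc xC *; first by rewrite scheme_col0 in xC.
  have [t tR <-] := collapsibleP xC.
  suff [] : P n t /\ P n.+1 (cmap S t) by [].
  by apply: PR => // [|j _]; [|apply: IH => //]; exact: Adown.
move=> x An; have [xR|xR] := pselect (redundant S x); last exact: nonred.
elim/(well_founded_ind (@prec_wf n)): x xR => x IHx xR.
suff [] : P n x /\ P n.+1 (cmap S x) by [].
apply: PR => // j ji.
have [yR|] := pselect (redundant S (face j (cmap S x))); last exact: nonred.
by apply: IHx => //; split=> //; exists j.
Qed.

Lemma chi_bdry_essential (Q : X -> Prop) n (e : K n) :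
  on_faces (fun m (x : K m) => forall u : Delta m, Q (chi x u)) e ->
  forall v : Delta n, bdry xpredT v -> Q (chi e v).
Proof.
case: n e => [|n] e Qe v [k _ vk]; first by move/eqP: vk; rewrite bary0 oner_eq0.
by have [w ->] := cofaceP vk; rewrite -chi_face; exact: Qe.
Qed.

Lemma chi_bdry_redundant (Q : X -> Prop) n (t : K n) :
  (forall j, j != imap S t -> forall u : Delta n, Q (chi (face j (cmap S t)) u)) ->
  forall v : Delta n.+1, bdry (predC1 (imap S t)) v -> Q (chi (cmap S t) v).
Proof.
by move=> Qt v [k ki vk]; have [w ->] := cofaceP vk; rewrite -chi_face; exact: Qt.
Qed.

Lemma chi_redundant n (t : K n) (u : Delta n) : redundant S t ->
  chi t u = chi (cmap S t) (coface (imap S t) u).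
Proof. by move=> tR; rewrite -chi_face -scheme_face. Qed.

Lemma point_ind (Q : X -> Prop) :
  (forall n (e : K n) (u : Delta n), essential S e -> inside u ->
     (forall v : Delta n, bdry xpredT v -> Q (chi e v)) -> Q (chi e u)) ->
  (forall n (t : K n) (u : Delta n.+1), redundant S t ->
     inner (predC1 (imap S t)) u ->
     (forall v : Delta n.+1, bdry (predC1 (imap S t)) v -> Q (chi (cmap S t) v)) ->
     Q (chi (cmap S t) u)) ->
  forall p, Q p.
Proof.
move=> QE QR p; have [n [x [w ->]]] := chi_surj p.
pose P n (x : K n) := forall u : Delta n, Q (chi x u).
suff PX : forall n (x : K n), True -> P n x by exact: PX.
apply: simplex_ind => //.
- by move=> m j y Qy u; rewrite chi_degen; exact: Qy.
- move=> m e _ eE /chi_bdry_essential Qe u.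
  by have [ui|/Qe//] := inner_or_bdry xpredT u; exact: QE.
- move=> m t _ tR /chi_bdry_redundant Qt.
  have Qct : P m.+1 (cmap S t).
    move=> u; have [ui|/Qt//] := inner_or_bdry (predC1 (imap S t)) u.
    exact: QR.
  by split=> // u; rewrite chi_redundant.
Qed.

(** The pieces on which recursion takes place: the open essential cells, and for
    each redundant [t] the union of its open cell with that of its partner.  In the
    second case the coordinates are those of the partner, and the one at the vertex
    opposite to [t] may vanish. *)
Inductive cell_point :=
| EssPoint n of K n & Delta n
| RedPoint n of K n & Delta n.+1.

Definition proper_point a := match a with
  | EssPoint n e u => essential S e /\ inside u
  | RedPoint n t u => redundant S t /\ inner (predC1 (imap S t)) u
  end.

Definition point_value a : X := match a with
  | EssPoint n e u => chi e u
  | RedPoint n t u => chi (cmap S t) u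
  end.

Lemma proper_point_exists p : exists2 a, proper_point a & point_value a = p.
Proof.
elim/point_ind: p => n x u xS ui _; first by exists (EssPoint x u).
by exists (RedPoint x u).
Qed.

Lemma redpoint_cases n (t : K n) (u : Delta n.+1) :
  redundant S t -> inner (predC1 (imap S t)) u ->
  inside u \/ exists w, [/\ u = coface (imap S t) w, inside w &
    chi (cmap S t) u = chi t w].
Proof.
move=> tR ui; have [?|[k _ uk]] := inner_or_bdry xpredT u; first by left.
have ki : k = imap S t.
  by apply/eqP; case: eqP => // /eqP/ui; rewrite uk ltxx.
subst k; have [w def_u] := cofaceP uk; right; exists w; split => //.
  move=> k _; rewrite -(bary_coface_lift (imap S t)) -def_u; apply: ui => /=.
  by rewrite eq_sym neq_lift.
by rewrite def_u -chi_redundant.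
Qed.

Lemma simplex_point_type (P : forall n, K n -> Prop) m n (x : K m) (y : K n)
    (u : Delta m) (v : Delta n) :
  simplex_point x u = simplex_point y v -> P m x -> P n y.
Proof. by move/(congr1 (fun a => P (projT1 a) (projT2 a).1)) => /= ->. Qed.

Lemma simplex_point_dim m n (x : K m) (y : K n) (u : Delta m) (v : Delta n) :
  simplex_point x u = simplex_point y v -> m = n.
Proof. by move/(congr1 (@projT1 _ _)). Qed.

Lemma essential_redundantF n (x : K n) : essential S x -> redundant S x -> False.
Proof. by move=> xE xR; have : set0 x by rewrite -(scheme_ess_red S). Qed.

Lemma essential_collapsibleF n (x : K n) :
  essential S x -> collapsible S x -> False.
Proof. by move=> xE xR; have : set0 x by rewrite -(scheme_ess_col S). Qed.

Lemma redundant_collapsibleF n (x : K n) :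
  redundant S x -> collapsible S x -> False.
Proof. by move=> xE xR; have : set0 x by rewrite -(scheme_red_col S). Qed.

Lemma essential_redundant_point m n (e : K m) (u : Delta m) (t : K n) (v : Delta n.+1) :
  essential S e -> inside u -> redundant S t -> inner (predC1 (imap S t)) v ->
  chi e u <> chi (cmap S t) v.
Proof.
move=> eE ui tR vi; have ec := essential_cell eE.
have [vint|[w [_ wint ->]]] := redpoint_cases tR vi.
  move/(chi_cell_inj ec ui (cmap_cell tR) vint).
  move/(@simplex_point_type (@essential K S)) => /(_ eE).
  by move=> /essential_collapsibleF; apply; exact: cmap_collapsible.
move/(chi_cell_inj ec ui (redundant_cell tR) wint).
move/(@simplex_point_type (@essential K S)) => /(_ eE).
by move/essential_redundantF; apply.
Qed.

Lemma redundant_collapsible_point m n (s : K m) (u : Delta m) (t : K n)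
    (v : Delta n.+1) :
  redundant S s -> inside u -> redundant S t -> inside v ->
  chi s u <> chi (cmap S t) v.
Proof.
move=> sR ui tR vi.
move/(chi_cell_inj (redundant_cell sR) ui (cmap_cell tR) vi).
move/(@simplex_point_type (@redundant K S)) => /(_ sR).
by move=> /redundant_collapsibleF; apply; exact: cmap_collapsible.
Qed.

Lemma proper_point_inj a b : proper_point a -> proper_point b ->
  point_value a = point_value b -> a = b.
Proof.
case: a => [m e u|m t u]; case: b => [n e' v|n t' v] /= [xS ui] [yS vi].
- move/(chi_cell_inj (essential_cell xS) ui (essential_cell yS) vi) => euev.
  have ? := simplex_point_dim euev; subst n.
  by have [-> ->] := simplex_point_inj euev.
- by move/essential_redundant_point => /(_ xS ui yS vi).
- by move/esym/essential_redundant_point => /(_ yS vi xS ui).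
have [uint|[u' [def_u u'int ->]]] := redpoint_cases xS ui;
  have [vint|[v' [def_v v'int ->]]] := redpoint_cases yS vi.
- move/(chi_cell_inj (cmap_cell xS) uint (cmap_cell yS) vint) => euev.
  have [?] := simplex_point_dim euev; subst n.
  by have [/(cmap_inj xS yS) -> ->] := simplex_point_inj euev.
- by move/esym/redundant_collapsible_point => /(_ yS v'int xS uint).
- by move/redundant_collapsible_point => /(_ xS u'int yS vint).
- move/(chi_cell_inj (redundant_cell xS) u'int (redundant_cell yS) v'int) => euev.
  have ? := simplex_point_dim euev; subst n.
  have [tt' u'v'] := simplex_point_inj euev.
  by rewrite def_u def_v tt' u'v'.
Qed.

Definition carrier p : cell_point := sval (cid2 (proper_point_exists p)).

Lemma carrierE a : proper_point a -> carrier (point_value a) = a.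
Proof.
rewrite /carrier; case: cid2 => b /= bP ab aP; exact: proper_point_inj.
Qed.

Section recursion.
Variables (V : Type) (PhiE : forall n, K n -> Delta n -> (Delta n -> V) -> V)
  (PhiR : forall n, K n -> Delta n.+1 -> (Delta n.+1 -> V) -> V).
Hypothesis PhiE_local : forall n (e : K n) u phi phi',
  (forall v, bdry xpredT v -> phi v = phi' v) -> PhiE e u phi = PhiE e u phi'.
Hypothesis PhiR_local : forall n (t : K n) u phi phi',
  (forall v, bdry (predC1 (imap S t)) v -> phi v = phi' v) ->
  PhiR t u phi = PhiR t u phi'.

Let below (q p : X) : Prop := match carrier p with
  | EssPoint n e u => exists2 v : Delta n, bdry xpredT v & q = chi e v
  | RedPoint n t u => exists2 v : Delta n.+1, bdry (predC1 (imap S t)) v &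
      q = chi (cmap S t) v
  end.

Let below_wf : well_founded below.
Proof.
elim/point_ind => n x u xS ui IH; constructor=> q; rewrite /below.
  have -> : carrier (chi x u) = EssPoint x u.
    exact: (@carrierE (EssPoint x u) (conj xS ui)).
  by move=> [v vb ->]; exact: IH.
have -> : carrier (chi (cmap S x) u) = RedPoint x u.
  exact: (@carrierE (RedPoint x u) (conj xS ui)).
by move=> [v vb ->]; exact: IH.
Qed.

(** A function on |K| may be defined on each piece from its values on the part
    of the boundary of the piece that belongs to lower pieces: the whole boundary of
    an essential cell, the horn of a redundant one.  Since functions live on points
    of |K|, no compatibility with faces or degeneracies has to be checked. *)
Lemma point_recursion (d : X -> V) : exists f : X -> V,
  (forall n (e : K n) (u : Delta n), essential S e -> inside u ->
     f (chi e u) = PhiE e u (fun v => f (chi e v))) /\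
  (forall n (t : K n) (u : Delta n.+1), redundant S t ->
     inner (predC1 (imap S t)) u ->
     f (chi (cmap S t) u) = PhiR t u (fun v => f (chi (cmap S t) v))).
Proof.
pose ext p (f : forall q, below q p -> V) q : V :=
  if pselect (below q p) is left qp then f q qp else d p.
pose F p (f : forall q, below q p -> V) : V := match carrier p with
  | EssPoint n e u => PhiE e u (fun v => ext p f (chi e v))
  | RedPoint n t u => PhiR t u (fun v => ext p f (chi (cmap S t) v))
  end.
have FE p f g : (forall q qp, f q qp = g q qp) -> F p f = F p g.
  by move=> fg; congr F; apply/functional_extensionality_dep => q;
     apply/functional_extensionality_dep => qp.
(* The default value [d] makes the boundary data total functions. *)
exists (Fix below_wf (fun=> V) F); split=> n x u xS ui; rewrite (Fix_eq _ _ _ FE) /F.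
  have xuE : carrier (chi x u) = EssPoint x u.
    exact: (@carrierE (EssPoint x u) (conj xS ui)).
  rewrite xuE.
  apply: PhiE_local => v vb; rewrite /ext; case: pselect => // -[].
  by rewrite /below xuE; exists v.
have xuE : carrier (chi (cmap S x) u) = RedPoint x u.
  exact: (@carrierE (RedPoint x u) (conj xS ui)).
rewrite xuE.
apply: PhiR_local => v vb; rewrite /ext; case: pselect => // -[].
by rewrite /below xuE; exists v.
Qed.

End recursion.

End scheme.

(** * Continuity tools *)
Section real_valued.
Variables (R : realType) (T : topologicalType).
Implicit Types f g : T -> R.

Lemma contD f g : continuous f -> continuous g -> continuous (fun x => f x + g x).
Proof. by move=> fc gc x; exact: (continuousD (fc x) (gc x)). Qed.

Lemma contN f : continuous f -> continuous (fun x => - f x).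
Proof. by move=> fc x; exact: (continuousN (fc x)). Qed.

Lemma contM f g : continuous f -> continuous g -> continuous (fun x => f x * g x).
Proof. by move=> fc gc x; exact: (continuousM (fc x) (gc x)). Qed.

Lemma contV f : (forall x, f x != 0) -> continuous f -> continuous (fun x => (f x)^-1).
Proof. by move=> f0 fc x; exact: (continuousV (f0 x) (fc x)). Qed.

Lemma cont_min f g :
  continuous f -> continuous g -> continuous (fun x => Num.min (f x) (g x)).
Proof. by move=> fc gc x; exact: (continuous_min (fc x) (gc x)). Qed.

Lemma cont_max f g :
  continuous f -> continuous g -> continuous (fun x => Num.max (f x) (g x)).
Proof. by move=> fc gc x; exact: (continuous_max (fc x) (gc x)). Qed.

Lemma cont_sum (I : Type) (s : seq I) (P : pred I) (F : I -> T -> R) :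
  (forall i, continuous (F i)) -> continuous (fun x => \sum_(i <- s | P i) F i x).
Proof.
move=> Fc; elim: s => [|i s IH].
  rewrite (_ : (fun _ => _) = fun=> 0); first exact: cst_continuous.
  by apply/funext => x; rewrite big_nil.
rewrite (_ : (fun _ => _) = fun x => (if P i then F i x else 0)
   + \sum_(i <- s | P i) F i x).
  by apply: contD => //; case: (P i) => //; exact: cst_continuous.
by apply/funext => x; rewrite big_cons; case: (P i); rewrite ?add0r.
Qed.

Lemma cont_bigmin (I : Type) (s : seq I) (P : pred I) (F : I -> T -> R) c :
  (forall i, continuous (F i)) ->
  continuous (fun x => \big[Num.min/c]_(i <- s | P i) F i x).
Proof.
move=> Fc; elim: s => [|i s IH].
  rewrite (_ : (fun _ => _) = fun=> c); first exact: cst_continuous.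
  by apply/funext => x; rewrite big_nil.
case Pi : (P i); last first.
  rewrite (_ : (fun _ => _) = fun x => \big[Num.min/c]_(i <- s | P i) F i x)//.
  by apply/funext => x; rewrite big_cons Pi.
rewrite (_ : (fun _ => _) = fun x => Num.min (F i x)
   (\big[Num.min/c]_(i <- s | P i) F i x)).
  exact: cont_min.
by apply/funext => x; rewrite big_cons Pi.
Qed.

Lemma closed_le_fun f g : continuous f -> continuous g -> closed [set x | f x <= g x].
Proof.
move=> fc gc; rewrite (_ : [set x | _] = (fun x => g x - f x) @^-1` [set y | 0 <= y]).
  have /continuous_closedP : continuous (fun x => g x - f x).
    by apply: contD => //; exact: contN.
  by apply; exact: closed_ge.
by apply/seteqP; split=> x /=; rewrite subr_ge0.
Qed.

Lemma closed_zero f : continuous f -> closed [set x | f x = 0].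
Proof.
move=> fc; rewrite (_ : [set x | _] = f @^-1` [set 0])//.
by move/continuous_closedP: fc; apply; exact: closed_eq.
Qed.

End real_valued.

Section within.
Variables (T U V : topologicalType).

Lemma within_comp (A : set T) (B : set U) (f : T -> U) (g : U -> V) :
  {within A, continuous f} -> (forall x, A x -> B (f x)) ->
  {within B, continuous g} -> {within A, continuous (g \o f)}.
Proof.
rewrite !subspace_continuousP => fc AB gc x Ax W /(gc _ (AB _ Ax)) /= gW.
have := fc _ Ax _ gW; rewrite /nbhs /= /within /=; apply: filterS.
by move=> y /= Wy Ay; exact: (Wy Ay (AB _ Ay)).
Qed.

Lemma within_bigU (n : nat) (A : 'I_n -> set T) (f : T -> U) :
  (forall k, closed (A k)) -> (forall k, {within A k, continuous f}) ->
  {within [set x | exists k, A k x], continuous f}.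
Proof.
elim: n A => [|n IH] A Acl Ac.
  rewrite (_ : [set x | _] = set0); first exact: continuous_subspace0.
  by apply/seteqP; split=> x // -[[]].
rewrite (_ : [set x | _] = A ord0 `|` [set x | exists k, A (lift ord0 k) x]).
  apply: withinU_continuous => //; last exact: IH.
  rewrite (_ : [set x | _] = \bigcup_(k in [set: 'I_n]) A (lift ord0 k)).
    by apply: closed_bigcup => //; exact: finite_finset.
  by apply/seteqP; split=> x [k]; [exists k|exists k].
apply/seteqP; split=> x; last by case=> [?|[k ?]]; [exists ord0|exists (lift ord0 k)].
by move=> [k Ak]; have [l kl|kl] := unliftP ord0 k; [right; exists l|left];
   rewrite -kl.
Qed.

Lemma continuous_U2 (A B : set T) (f : T -> U) : closed A -> closed B ->
  (forall x, A x \/ B x) -> {within A, continuous f} -> {within B, continuous f} ->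
  continuous f.
Proof.
move=> Acl Bcl AB fA fB; apply/continuous_subspace_setT.
rewrite (_ : setT = A `|` B); first exact: withinU_continuous.
by apply/seteqP; split=> x // _; exact: AB.
Qed.

End within.

Lemma cont_comp (T U V : topologicalType) (f : T -> U) (g : U -> V) :
  continuous f -> continuous g -> continuous (fun x => g (f x)).
Proof. by move=> fc gc x; apply: continuous_comp; [exact: fc|exact: gc]. Qed.

Lemma continuous_pair (T U V : topologicalType) (f : T -> U) (g : T -> V) :
  continuous f -> continuous g -> continuous (fun x => (f x, g x)).
Proof. by move=> fc gc x; apply: cvg_pair; [exact: fc|exact: gc]. Qed.

Lemma fst_continuous (T U : topologicalType) : continuous (@fst T U).
Proof. by move=> x; exact: cvg_fst. Qed.

Lemma snd_continuous (T U : topologicalType) : continuous (@snd T U).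
Proof. by move=> x; exact: cvg_snd. Qed.

Lemma into_subtype_continuous (T U : topologicalType) (A : set U) (f : T -> A) :
  continuous (fun x => \val (f x)) -> continuous f.
Proof.
move=> fc; apply/continuousP => _ [V Vo <-]; rewrite -comp_preimage.
by move/continuousP : fc; apply.
Qed.

Lemma val_continuous (U : topologicalType) (A : set U) :
  continuous (fun x : A => \val x).
Proof. exact: initial_continuous. Qed.

Lemma mx_coord_continuous (R : realType) m n (i : 'I_m) (j : 'I_n) :
  continuous (fun M : 'M[R]_(m, n) => M i j).
Proof.
move=> M W /= MW; exists (fun k l => [set x | k = i -> l = j -> W x]).
  move=> k l; have [[-> ->]|kl] := pselect (k = i /\ l = j).
    by apply: filterS MW => x Wx _ _.
  by apply: filterE => x ki lj; case: kl.
by move=> N /(_ i j); exact.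
Qed.

Lemma into_mx_continuous (R : realType) m n (T : topologicalType)
    (f : T -> 'M[R]_(m, n)) :
  (forall i j, continuous (fun x => f x i j)) -> continuous f.
Proof.
move=> fc x W [P fP PW].
have : \forall y \near x, forall ij : 'I_m * 'I_n, P ij.1 ij.2 (f y ij.1 ij.2).
  by apply: filter_forall => -[i j] /=; exact: (fc i j x _ (fP i j)).
by apply: filterS => y yP; apply: PW => i j; exact: (yP (i, j)).
Qed.

Section final.
Variables (R : realType) (X : topologicalType) (I : Type) (D : I -> topologicalType)
  (phi : forall i, D i -> X).

(** Joint surjectivity is part of the notion because it is used for the
    homotopies in [final_homotopy_continuous]. *)
Definition final_family := (forall x, exists i d, x = @phi i d) /\
  forall U : set X, (forall i, open (@phi i @^-1` U)) -> open U.

Lemma final_continuous (Z : topologicalType) (f : X -> Z) : final_family ->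
  (forall i, continuous (f \o @phi i)) -> continuous f.
Proof.
move=> [_ phiF] fc; apply/continuousP => W oW; apply: phiF => i.
by move/continuousP: (fc i); apply.
Qed.

(** A final topology stays final after a product with the line, because the line
    is locally compact: by the tube lemma, the points [x] for which [f] sends
    [x] times a compact interval into an open set form an open set. *)
Lemma final_homotopy_continuous (Z : topologicalType) (f : X * R -> Z) :
  final_family ->
  (forall i, continuous (fun p : D i * R => f (phi p.1, p.2))) -> continuous f.
Proof.
move=> [phis phiF] fc; apply/continuousP => W oW.
rewrite openE => -[x0 t0] /= Wxt; rewrite /interior.
have [i0 [d0 def_x0]] := phis x0.
pose g t := f (x0, t).
have gc : continuous g.
  rewrite (_ : g = (fun p => f (phi p.1, p.2)) \o (fun t : R => (d0, t))); last first.
    by rewrite /g def_x0.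
  move=> t; apply: continuous_comp; last exact: fc.
  by apply: continuous_pair; [exact: cst_continuous|move=> ?; exact: cvg_id].
have [e e0 eW] : exists2 e : R, 0 < e & forall t, `|t0 - t| < e -> W (g t).
  have : nbhs t0 (g @^-1` W) by apply: gc; apply: open_nbhs_nbhs.
  by move=> /nbhs_ballP[e e0 eW]; exists e.
pose N : set R := [set` `[t0 - e / 2, t0 + e / 2]].
have NW t : N t -> W (g t).
  rewrite /N /= in_itv /= => /andP[t1 t2]; apply: eW.
  apply: (@le_lt_trans _ _ (e / 2)); last by rewrite ltr_pdivrMr// ltr_pMr// ltr1n.
  by rewrite distrC ler_distl t1.
pose U : set X := [set x | forall t, N t -> W (f (x, t))].
exists (U, N) => /=; last by move=> [x t] [/= Ux Nt]; exact: Ux.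
split; last first.
  apply/nbhs_ballP; exists (e / 2); first by rewrite /= divr_gt0.
  move=> t; rewrite /ball /= distrC ltr_distl /N /= in_itv /= => /andP[? ?].
  by rewrite !ltW.
apply: open_nbhs_nbhs; split; last exact: NW.
apply: phiF => i; rewrite openE => d Ud; rewrite /interior.
have /compact_near_coveringP/(_ _ (nbhs d) (fun d t => W (f (phi d, t))) _) cov :
  compact N by exact: segment_compact.
apply: filterS (cov _) => [d' Nd' t Nt|t Nt]; first exact: Nd'.
have : nbhs (d, t) ((fun p : D i * R => f (phi p.1, p.2)) @^-1` W).
  by apply: fc; apply: open_nbhs_nbhs; split => //; exact: Ud.
move=> [[A B] /= [Ad Bt] ABW]; exists (B, A) => //= -[t' d'] [/= Bt' Ad'].
by apply: (ABW (d', t')).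
Qed.

End final.

Lemma discrete_prod_continuous (P : choiceType) (T Z : topologicalType)
    (f : discrete_topology P * T -> Z) :
  (forall p, continuous (fun t => f (p, t))) -> continuous f.
Proof.
move=> fc [p t] W Wpt; have : nbhs t ((fun t => f (p, t)) @^-1` W) by exact: fc.
move=> tW; exists ([set p], (fun t => f (p, t)) @^-1` W) => /=.
  by split => //; exact: discrete_set1.
by move=> [q s] [/= -> ?].
Qed.

Section simplices.
Variable R : realType.
Local Notation Delta := (std_simplex R).

Lemma bary_continuous n (k : 'I_n.+1) : continuous (fun u : Delta n => bary u k).
Proof.
move=> u; apply: (@continuous_comp _ _ _ (fun u : Delta n => \val u) (fun M => M ord0 k)).
  exact: val_continuous.
exact: mx_coord_continuous.
Qed.

Lemma into_simplex_continuous (T : topologicalType) n (f : T -> Delta n) :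
  (forall k, continuous (fun x => bary (f x) k)) -> continuous f.
Proof.
move=> fc; apply: into_subtype_continuous; apply: into_mx_continuous => i j.
by rewrite (ord1 i); exact: fc.
Qed.

Lemma simplex_map_continuous m n (f : 'I_m.+1 -> 'I_n.+1) :
  continuous (@simplex_map R m n f).
Proof.
apply: into_simplex_continuous => k.
rewrite (_ : (fun _ => _) = fun u => \sum_(l | f l == k) bary u l).
  by apply: cont_sum => l; exact: bary_continuous.
by apply/funext => u; rewrite bary_map.
Qed.

(** A degeneracy retracts a simplex onto each of its faces; this is what makes
    functions on a face continuous when read on the whole simplex. *)
Lemma coface_section n (k : 'I_n.+2) : exists2 s : Delta n.+1 -> Delta n,
  continuous s & cancel (coface k) s.
Proof.
have [j ->|->] := unliftP ord0 k.
  by exists (codegen j); [exact: simplex_map_continuous|exact: codegen_coface_eqS].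
exists (codegen ord0); first exact: simplex_map_continuous.
move=> v; rewrite -[RHS](codegen_coface_eq ord0); congr (codegen _ (coface _ _)).
Qed.

End simplices.

Section realisation_topology.
Variables (R : realType) (K : sset).
Local Notation Delta := (std_simplex R).
Local Notation X := (realisation R K).

Lemma chi_continuous n (x : K n) : continuous (@chi R K n x).
Proof.
move=> u; apply: (@continuous_comp _ _ _ (fun u => simplex_point x u) (@realisation_pi R K)).
  apply: (@continuous_comp _ _ _ (fun u => ((x : discrete_topology (K n)), u))
    (existT (fun n => discrete_topology (K n) * Delta n)%type n)).
    by apply: continuous_pair; [exact: cst_continuous|move=> ?; exact: cvg_id].
  exact: existT_continuous.
exact: pi_continuous.
Qed.

Lemma realisation_final :
  @final_family X {n & K n} (fun a => Delta (projT1 a)) (fun a => @chi R K _ (projT2 a)).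
Proof.
split=> [p|U Uo].
  by have [n [x [u ->]]] := chi_surj p; exists (existT _ n x), u.
apply/sigT_openP => n; rewrite openE => -[x u] Uxu; rewrite /interior.
exists ([set x], (@chi R K n x) @^-1` U) => /=.
  split; first exact: discrete_set1.
  by apply: open_nbhs_nbhs; split => //; exact: (Uo (existT _ n x)).
by move=> [y v] [/= -> ?].
Qed.

Variable S : collapsing_scheme K.

Lemma within_bdry (Z : topologicalType) n (x : K n.+1) (J : pred 'I_n.+2)
    (f : X -> R -> Z) :
  (forall j, J j -> continuous (fun p : Delta n * R => f (chi (face j x) p.1) p.2)) ->
  {within bdry J `*` setT,
    continuous (fun p : Delta n.+1 * R => f (chi x p.1) p.2)}.
Proof.
move=> fc; rewrite (_ : _ `*` _ = [set p : Delta n.+1 * R | exists k,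
    [set p : Delta n.+1 * R | J k /\ bary p.1 k = 0] p]); last first.
  apply/seteqP; split=> -[u t] /=; first by move=> [[k Jk uk] _]; exists k.
  by move=> [k [Jk uk]]; split=> //; exists k.
apply: within_bigU => k.
  have [Jk|Jk] := boolP (J k); last first.
    by rewrite (_ : [set p | _] = set0)//; [exact: closed0|apply/seteqP; split=> p // -[]].
  rewrite (_ : [set p | _] = [set p | bary p.1 k = 0]).
    apply: closed_zero.
    exact: (cont_comp (@fst_continuous _ _) (@bary_continuous _ _ k)).
  by apply/seteqP; split=> p => [[]|].
have [s sc ks] := @coface_section R n k.
have [Jk|Jk] := boolP (J k); last first.
  rewrite (_ : [set p | _] = set0); first exact: continuous_subspace0.
  by apply/seteqP; split=> p // -[].
apply: (@subspace_eq_continuous _ _ _ (fun p => f (chi (face k x) (s p.1)) p.2)).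
  move=> [u t]; rewrite inE /= => -[_ uk]; have [w ->] := cofaceP uk.
  by rewrite ks chi_face.
apply: continuous_subspaceT.
apply: (@cont_comp _ _ _ (fun p : Delta n.+1 * R => (s p.1, p.2))
   (fun p => f (chi (face k x) p.1) p.2)); last exact: fc.
apply: continuous_pair; last exact: snd_continuous.
exact: cont_comp (@fst_continuous _ _) sc.
Qed.

(** Continuity of a homotopy that is given by a formula on each piece: it is
    enough to go from the boundary part to the piece.  The parameter in [R] is
    carried along so that maps and homotopies are treated at once. *)
Lemma simplexwise_continuous (Z : topologicalType) (A : nat -> Prop) (f : X -> R -> Z) :
  (forall n, A n.+1 -> A n) ->
  (forall n (e : K n), A n -> essential S e ->
    {within bdry xpredT `*` setT,
      continuous (fun p : Delta n * R => f (chi e p.1) p.2)} ->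
    continuous (fun p : Delta n * R => f (chi e p.1) p.2)) ->
  (forall n (t : K n), A n -> redundant S t ->
    {within bdry (predC1 (imap S t)) `*` setT,
      continuous (fun p : Delta n.+1 * R => f (chi (cmap S t) p.1) p.2)} ->
    continuous (fun p : Delta n.+1 * R => f (chi (cmap S t) p.1) p.2)) ->
  forall n (x : K n), A n -> continuous (fun p : Delta n * R => f (chi x p.1) p.2).
Proof.
move=> Adown fE fR n x An.
have map_fst m l (s : Delta m -> Delta l) : continuous s ->
    continuous (fun p : Delta m * R => (s p.1, p.2)).
  move=> sc; apply: continuous_pair; last exact: snd_continuous.
  exact: cont_comp (@fst_continuous _ _) sc.
pose P n (x : K n) := continuous (fun p : Delta n * R => f (chi x p.1) p.2).
apply: (@simplex_ind K S A P) => //.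
- move=> m j y yc; rewrite /P (_ : (fun _ => _) = (fun p : Delta m * R => f (chi y p.1) p.2)
    \o (fun p : Delta m.+1 * R => (codegen j p.1, p.2))).
    move=> p; apply: continuous_comp; last exact: yc.
    by apply: map_fst; exact: simplex_map_continuous.
  by apply/funext => p /=; rewrite chi_degen.
- move=> m e Am eE ec; apply: fE => //; case: m e {Am eE} ec => [|m] e ec.
    rewrite (_ : _ `*` _ = set0); first exact: continuous_subspace0.
    apply/seteqP; split=> -[u t] // [[k _ /= uk] _].
    by move/eqP: uk; rewrite bary0 oner_eq0.
  by apply: within_bdry => j _; exact: ec.
- move=> m t Am tR tc.
  have Pct : P m.+1 (cmap S t) by apply: fR => //; exact: within_bdry.
  split=> //; rewrite /P (_ : (fun _ => _) =
      (fun p : Delta m.+1 * R => f (chi (cmap S t) p.1) p.2)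
      \o (fun p : Delta m * R => (coface (imap S t) p.1, p.2))).
    move=> p; apply: continuous_comp; last exact: Pct.
    by apply: map_fst; exact: simplex_map_continuous.
  by apply/funext => p /=; rewrite -chi_redundant.
Qed.

End realisation_topology.

(** * Pushing points of a simplex to its boundary *)
Section geometry.
Variable R : realType.
Local Notation Delta := (std_simplex R).

Definition bary_min n (J : pred 'I_n.+1) (u : Delta n) : R :=
  \big[Num.min/1]_(k | J k) bary u k.

Lemma bary_le1 n (u : Delta n) k : bary u k <= 1.
Proof.
rewrite -[leRHS](bary_sum u) (bigD1 k)//= lerDl sumr_ge0// => l _; exact: bary_ge0.
Qed.

Lemma bary_min_le n (J : pred 'I_n.+1) (u : Delta n) k : J k -> bary_min J u <= bary u k.
Proof. by move=> Jk; exact: bigmin_le_cond. Qed.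

Lemma bary_min_ge0 n (J : pred 'I_n.+1) (u : Delta n) : 0 <= bary_min J u.
Proof. by apply/bigmin_geP; split=> // k _; exact: bary_ge0. Qed.

Lemma bary_min_attained n (J : pred 'I_n.+1) (u : Delta n) : (exists k, J k) ->
  exists2 k, J k & bary_min J u = bary u k.
Proof.
move=> [k0 Jk0]; have [||k Jk mk] := @eq_bigmin _ _ _ 1 k0 J (bary u) => //.
  by move=> k _; exact: bary_le1.
by exists k.
Qed.

Lemma bary_min_bdry n (J : pred 'I_n.+1) (u : Delta n) : bdry J u -> bary_min J u = 0.
Proof.
by move=> [k Jk uk]; apply/eqP; rewrite eq_le bary_min_ge0 -uk bary_min_le.
Qed.

Lemma bary_min_continuous n (J : pred 'I_n.+1) : continuous (@bary_min n J).
Proof. by apply: cont_bigmin => k; exact: bary_continuous. Qed.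

Lemma bary_min_mean n (u : Delta n) : n.+1%:R * bary_min xpredT u <= 1.
Proof.
rewrite -[leRHS](bary_sum u) mulr_natl.
have <- : \sum_(k < n.+1) bary_min xpredT u = bary_min xpredT u *+ n.+1.
  by rewrite sumr_const card_ord.
by apply: ler_sum => k _; exact: bary_min_le.
Qed.

Definition barycentric n (w : 'I_n.+1 -> R) : Prop :=
  (forall k, 0 <= w k) /\ \sum_k w k = 1.

(** Total version of [simplex_of], so that formulas for moving points need no
    proof arguments; [u] is a junk value. *)
Definition simplex_or n (u : Delta n) (w : 'I_n.+1 -> R) : Delta n :=
  if pselect (barycentric w) is left wb then simplex_of wb.1 wb.2 else u.

Lemma bary_simplex_or n (u : Delta n) w k : barycentric w ->
  bary (simplex_or u w) k = w k.
Proof.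
by rewrite /simplex_or; case: pselect => // wb _; rewrite bary_simplex_of.
Qed.

Lemma simplex_or_continuous (T : topologicalType) n (u : T -> Delta n)
    (w : T -> 'I_n.+1 -> R) :
  (forall x, barycentric (w x)) -> (forall k, continuous (w ^~ k)) ->
  continuous (fun x => simplex_or (u x) (w x)).
Proof.
move=> wb wc; apply: into_simplex_continuous => k.
rewrite (_ : (fun _ => _) = w^~ k)//.
by apply/funext => x; rewrite bary_simplex_or.
Qed.

(** Motion of speed one, towards the vertex [k0], in the direction that lowers
    all other coordinates equally.  It stops on the horn at time
    [bary_min (predC1 k0) u]. *)
Definition push_coords n (k0 : 'I_n.+2) (w : R) (u : Delta n.+1) (k : 'I_n.+2) : R :=
  if k == k0 then bary u k + n.+1%:R * w else bary u k - w.

Definition push n (k0 : 'I_n.+2) (w : R) (u : Delta n.+1) : Delta n.+1 :=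
  simplex_or u (push_coords k0 w u).

Local Notation horn_min k0 := (bary_min (predC1 k0)).

Lemma push_coords_bary n (k0 : 'I_n.+2) w (u : Delta n.+1) :
  0 <= w <= horn_min k0 u -> barycentric (push_coords k0 w u).
Proof.
move=> /andP[w0 wm]; split=> [k|].
  rewrite /push_coords; case: eqP => [_|/eqP kk0].
    by rewrite addr_ge0 ?bary_ge0// mulr_ge0.
  by rewrite subr_ge0 (le_trans wm)// bary_min_le.
rewrite (bigD1 k0)//= /push_coords eqxx.
under eq_bigr => k /negbTE -> do [].
rewrite sumrB sumr_const (_ : #|_| = n.+1); last first.
  by have := cardC1 k0; rewrite card_ord.
rewrite -[RHS](bary_sum u) [in RHS](bigD1 k0)//= -[w *+ n.+1]mulr_natl; ring.
Qed.

Lemma bary_push n (k0 : 'I_n.+2) w (u : Delta n.+1) k : 0 <= w <= horn_min k0 u ->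
  bary (push k0 w u) k = if k == k0 then bary u k + n.+1%:R * w else bary u k - w.
Proof. by move=> wu; rewrite bary_simplex_or//; exact: push_coords_bary. Qed.

Lemma push0 n (k0 : 'I_n.+2) (u : Delta n.+1) : push k0 0 u = u.
Proof.
apply: bary_inj => k; rewrite bary_push ?lexx ?bary_min_ge0//.
by rewrite mulr0 addr0 subr0 if_same.
Qed.

Lemma horn_nonempty n (k0 : 'I_n.+2) : exists k, predC1 k0 k.
Proof. by exists (lift k0 ord0); rewrite /= eq_sym neq_lift. Qed.

Lemma horn_min_push n (k0 : 'I_n.+2) w (u : Delta n.+1) : 0 <= w <= horn_min k0 u ->
  horn_min k0 (push k0 w u) = horn_min k0 u - w.
Proof.
move=> wu; apply/le_anti/andP; split.
  have [k kk0 ->] := bary_min_attained u (horn_nonempty k0).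
  by apply: (le_trans (bary_min_le _ kk0)); rewrite bary_push// (negbTE kk0).
have [k kk0 ->] := bary_min_attained (push k0 w u) (horn_nonempty k0).
by rewrite bary_push// (negbTE kk0) lerD2r bary_min_le.
Qed.

Definition to_horn n (k0 : 'I_n.+2) (u : Delta n.+1) := push k0 (horn_min k0 u) u.

(** The pushing lines are parallel, so the end point on the horn is constant
    along each of them. *)
Lemma to_horn_push n (k0 : 'I_n.+2) w (u : Delta n.+1) : 0 <= w <= horn_min k0 u ->
  to_horn k0 (push k0 w u) = to_horn k0 u.
Proof.
move=> wu; have m0 := bary_min_ge0 (predC1 k0) u; have /andP[w0 wm] := wu.
apply: bary_inj => k; rewrite !bary_push ?horn_min_push// ?lexx ?m0 ?subr_ge0 ?wm//.
by case: eqP => _; ring.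
Qed.

Lemma to_horn_in_bdry n (k0 : 'I_n.+2) (u : Delta n.+1) :
  bdry (predC1 k0) (to_horn k0 u).
Proof.
have [k kk0 mk] := bary_min_attained u (horn_nonempty k0); exists k => //.
by rewrite bary_push ?lexx ?bary_min_ge0// (negbTE kk0) mk subrr.
Qed.

Lemma to_horn_bdry n (k0 : 'I_n.+2) (u : Delta n.+1) :
  bdry (predC1 k0) u -> to_horn k0 u = u.
Proof. by move=> /bary_min_bdry m0; rewrite /to_horn m0 push0. Qed.

Lemma push_continuous (T : topologicalType) n (k0 : 'I_n.+2) (w : T -> R)
    (u : T -> Delta n.+1) :
  continuous w -> continuous u -> (forall x, 0 <= w x <= horn_min k0 (u x)) ->
  continuous (fun x => push k0 (w x) (u x)).
Proof.
move=> wc uc wu; apply: simplex_or_continuous => [x|k].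
  exact: push_coords_bary.
have ukc := cont_comp uc (@bary_continuous R _ k).
rewrite /push_coords; case: eqP => _; apply: contD => //.
  by apply: contM => //; exact: cst_continuous.
exact: contN.
Qed.

(** Radial motion away from the barycentre; it reaches the boundary when [w] is
    the smallest coordinate of [u].  The restriction [n.+1 * w < 1] keeps away from
    the singularity at the barycentre itself. *)
Definition shrink_coords n (w : R) (u : Delta n) (k : 'I_n.+1) : R :=
  (bary u k - w) / (1 - n.+1%:R * w).

Definition shrink n (w : R) (u : Delta n) : Delta n :=
  simplex_or u (shrink_coords w u).

Lemma shrink_coords_bary n w (u : Delta n) :
  0 <= w <= bary_min xpredT u -> n.+1%:R * w < 1 -> barycentric (shrink_coords w u).
Proof.
move=> /andP[w0 wm] w1; split=> [k|].
  by rewrite divr_ge0 ?subr_ge0 ?(ltW w1)// (le_trans wm)// bary_min_le.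
rewrite /shrink_coords -mulr_suml sumrB bary_sum sumr_const card_ord -[w *+ _]mulr_natl.
by rewrite divff// subr_eq0 gt_eqF.
Qed.

Lemma bary_shrink n w (u : Delta n) k :
  0 <= w <= bary_min xpredT u -> n.+1%:R * w < 1 ->
  bary (shrink w u) k = (bary u k - w) / (1 - n.+1%:R * w).
Proof. by move=> wu w1; rewrite bary_simplex_or//; exact: shrink_coords_bary. Qed.

Lemma shrink0 n (u : Delta n) : shrink 0 u = u.
Proof.
apply: bary_inj => k; rewrite bary_shrink ?lexx ?bary_min_ge0 ?mulr0//.
by rewrite !subr0 divr1.
Qed.

Lemma shrink_bdry n (u : Delta n) : n.+1%:R * bary_min xpredT u < 1 ->
  bdry xpredT (shrink (bary_min xpredT u) u).
Proof.
have [|k _ mk] := @bary_min_attained n xpredT u; first by exists ord0.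
move=> m1; exists k => //; rewrite bary_shrink ?lexx ?bary_min_ge0//.
by rewrite mk subrr mul0r.
Qed.

Lemma shrink_continuous (T : topologicalType) n (w : T -> R) (u : T -> Delta n) :
  continuous w -> continuous u ->
  (forall x, 0 <= w x <= bary_min xpredT (u x)) -> (forall x, n.+1%:R * w x < 1) ->
  continuous (fun x => shrink (w x) (u x)).
Proof.
move=> wc uc wu w1; apply: simplex_or_continuous => [x|k].
  exact: shrink_coords_bary.
have ukc := cont_comp uc (@bary_continuous R _ k).
apply: contM; first by apply: contD => //; exact: contN.
apply: contV; first by move=> x; rewrite subr_eq0 gt_eqF.
apply: contD; first exact: cst_continuous.
by apply/contN/contM => //; exact: cst_continuous.
Qed.

End geometry.

(** * The collapse *)
Section collapse.
Variables (R : realType) (K : sset) (S : collapsing_scheme K).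
Local Notation Delta := (std_simplex R).
Local Notation X := (realisation R K).

Lemma collapse_exists : exists f : X -> X,
  (forall n (e : K n) (u : Delta n), essential S e -> inside u ->
     f (chi e u) = chi e u) /\
  (forall n (t : K n) (u : Delta n.+1), redundant S t ->
     inner (predC1 (imap S t)) u ->
     f (chi (cmap S t) u) = f (chi (cmap S t) (to_horn (imap S t) u))).
Proof.
pose PE n (e : K n) (u : Delta n) (_ : Delta n -> X) : X := chi e u.
pose PR n (t : K n) (u : Delta n.+1) (phi : Delta n.+1 -> X) : X :=
  phi (to_horn (imap S t) u).
apply: (@point_recursion R K S X PE PR) => // n t u phi phi' pp'.
by apply: pp'; exact: to_horn_in_bdry.
Qed.

Definition collapse : X -> X := sval (cid collapse_exists).

Lemma collapse_essential n (e : K n) (u : Delta n) :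
  essential S e -> inside u -> collapse (chi e u) = chi e u.
Proof. by rewrite /collapse; case: cid => f /= [fE _]; exact: fE. Qed.

(** The defining equation also holds for points of the horn, which [to_horn]
    fixes, so that the two kinds of points need not be separated. *)
Lemma collapse_redundant n (t : K n) (u : Delta n.+1) : redundant S t ->
  collapse (chi (cmap S t) u) = collapse (chi (cmap S t) (to_horn (imap S t) u)).
Proof.
move=> tR; have [ui|/to_horn_bdry ->//] := inner_or_bdry (predC1 (imap S t)) u.
by rewrite /collapse; case: cid => f /= [_ fR]; exact: fR.
Qed.

Lemma collapse_push n (t : K n) (u : Delta n.+1) w : redundant S t ->
  0 <= w <= bary_min (predC1 (imap S t)) u ->
  collapse (chi (cmap S t) (push (imap S t) w u)) = collapse (chi (cmap S t) u).
Proof.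
by move=> tR wu; rewrite collapse_redundant// to_horn_push// -collapse_redundant.
Qed.

End collapse.

(** * The flow *)
Section clock.
Variable R : realType.
Implicit Types (n : nat) (t : R).

Definition stage_time n : R := 2^-1 ^+ n.

Lemma stage_time_gt0 n : 0 < stage_time n.
Proof. by apply: exprn_gt0; rewrite invr_gt0. Qed.

Lemma stage_timeS n : stage_time n = 2 * stage_time n.+1.
Proof. by rewrite /stage_time exprS mulrA divff ?mul1r// pnatr_eq0. Qed.

Lemma stage_time_leS n : stage_time n.+1 <= stage_time n.
Proof. by rewrite [leRHS]stage_timeS; have := stage_time_gt0 n.+1; lra. Qed.

Lemma stage_time_le1 n : stage_time n <= 1.
Proof. by rewrite exprn_ile1 ?invr_ge0// invf_le1// ler1n. Qed.

(** Local clock of the slot in which the redundant [n]-cells move: it runs from 0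
    to 1 while [t] goes from [stage_time n.+1] to [stage_time n]. *)
Definition slot n t : R :=
  Num.min 1 (Num.max 0 ((t - stage_time n.+1) / stage_time n.+1)).

Lemma slot_ge0 n t : 0 <= slot n t.
Proof. by rewrite le_min ler01 le_max lexx. Qed.

Lemma slot_le1 n t : slot n t <= 1.
Proof. by rewrite ge_min lexx. Qed.

Lemma slot_early n t : t <= stage_time n.+1 -> slot n t = 0.
Proof.
move=> ta; rewrite /slot max_l ?min_r ?ler01//.
by rewrite pmulr_lle0 ?invr_gt0 ?stage_time_gt0// subr_le0.
Qed.

Lemma slot_late n t : stage_time n <= t -> slot n t = 1.
Proof.
move=> ta; have a0 := stage_time_gt0 n.+1; rewrite /slot min_l// le_max.
apply/orP; right; rewrite ler_pdivlMr// mul1r.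
by move: ta; rewrite stage_timeS; lra.
Qed.

Lemma slot_between n t : 0 < slot n t < 1 ->
  t = stage_time n.+1 * (1 + slot n t).
Proof.
have a0 := stage_time_gt0 n.+1; rewrite /slot.
set q := (t - _) / _; have tq : t = stage_time n.+1 * (1 + q).
  by rewrite /q; field; rewrite gt_eqF.
rewrite /Num.max; case: (ltP 0 q) => q0; rewrite /Num.min; case: (ltP 1 _) => q1;
  by rewrite ?ltxx ?andbF//.
Qed.

Lemma slot_gt0 n t : stage_time n.+1 < t -> 0 < slot n t.
Proof.
move=> ta; rewrite lt_min ltr01 lt_max divr_gt0 ?orbT// ?stage_time_gt0//.
by rewrite subr_gt0.
Qed.

Lemma slot_continuous n : continuous (slot n).
Proof.
apply: cont_min; first exact: cst_continuous.
apply: cont_max; first exact: cst_continuous.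
apply: contM; last exact: cst_continuous.
by apply: contD; [move=> ?; exact: cvg_id|exact: cst_continuous].
Qed.

(** Time elapsed since the essential [n]-cells were allowed to move. *)
Definition delay n t : R := Num.max 0 (t - stage_time n).

Lemma delay_ge0 n t : 0 <= delay n t. Proof. by rewrite le_max lexx. Qed.

Lemma delay_early n t : t <= stage_time n -> delay n t = 0.
Proof. by move=> ta; rewrite /delay max_l// subr_le0. Qed.

Lemma delay_late n t : stage_time n <= t -> delay n t = t - stage_time n.
Proof. by move=> ta; rewrite /delay max_r// subr_ge0. Qed.

Lemma delay_continuous n : continuous (delay n).
Proof.
apply: cont_max; first exact: cst_continuous.
by apply: contD; [move=> ?; exact: cvg_id|exact: cst_continuous].
Qed.

End clock.
Arguments stage_time R n : clear implicits.

(** Common shape of the two clauses of the flow: a point first moves freely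
    inside its piece; once its motion [P] has taken it to the boundary part, it
    follows the homotopy already given there, with a corrected time [tau]. *)
Lemma glue_continuous (R : realType) (D Z : topologicalType) (v m tau : D * R -> R)
    (P : D * R -> D) (f : D -> Z) (h : D * R -> Z) (B : set D) :
  continuous v -> continuous m -> continuous tau -> continuous P -> continuous f ->
  {within B `*` setT, continuous h} ->
  (forall x, m x <= v x -> B (P x)) ->
  (forall x, v x = m x -> h (P x, tau x) = f (P x)) ->
  continuous (fun x => if v x <= m x then f (P x) else h (P x, tau x)).
Proof.
move=> vc mc tauc Pc fc hc mvB vmE.
apply: (@continuous_U2 _ _ [set x | v x <= m x] [set x | m x <= v x]).
- exact: (closed_le_fun vc mc).
- exact: (closed_le_fun mc vc).
- by move=> x; apply/orP; exact: le_total.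
- apply: (@subspace_eq_continuous _ _ _ (f \o P)).
    by move=> x /set_mem /= vm; rewrite /from_subspace /= vm.
  by apply: continuous_subspaceT; exact: cont_comp.
- apply: (@subspace_eq_continuous _ _ _ (h \o (fun x => (P x, tau x)))).
    move=> x /set_mem /= mv; rewrite /from_subspace /=; case: (leP (v x) (m x)) => // vm.
    by rewrite vmE//; apply/le_anti; rewrite vm.
  apply: (within_comp _ _ hc).
    by apply: continuous_subspaceT; exact: continuous_pair.
  by move=> x /= /mvB.
Qed.

Section flow.
Variables (R : realType) (K : sset) (S : collapsing_scheme K).
Local Notation Delta := (std_simplex R).
Local Notation X := (realisation R K).
Local Notation stage_time := (stage_time R).

Section essential_move.
Variable n : nat.
Implicit Types (u : Delta n) (t : R).
Local Notation depth u := (bary_min xpredT u).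

(** On an essential cell the flow is the usual extension of a homotopy from the
    boundary: points near the barycentre are expanded by the factor [1 + delay],
    and a point that has left the cell follows the flow of its exit point.  In terms
    of [shrink] that expansion is a motion by this amount. *)
Definition ess_shift t : R := delay n t / ((1 + delay n t) * n.+1%:R).

Definition ess_move u t : Delta n := shrink (Num.min (ess_shift t) (depth u)) u.

(** It equals [stage_time n] at the moment of exit ([ess_time_exit]) and, on the
    boundary, the true time once it is past [stage_time n]. *)
Definition ess_time u t : R :=
  stage_time n + delay n t - n.+1%:R * depth u * (1 + delay n t).

Lemma delay1_gt0 t : 0 < 1 + delay n t.
Proof. by rewrite ltr_pwDl// delay_ge0. Qed.

Lemma ess_shift_ge0 t : 0 <= ess_shift t.
Proof. by rewrite divr_ge0 ?delay_ge0// mulr_ge0// ltW// delay1_gt0. Qed.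

Lemma ess_shift_lt t : n.+1%:R * ess_shift t < 1.
Proof.
have -> : n.+1%:R * ess_shift t = delay n t / (1 + delay n t).
  by rewrite /ess_shift; field; rewrite gt_eqF ?delay1_gt0//= nat1r pnatr_eq0.
by rewrite ltr_pdivrMr ?delay1_gt0// mul1r ltrDr.
Qed.

Lemma ess_shift_early t : t <= stage_time n -> ess_shift t = 0.
Proof. by move=> ta; rewrite /ess_shift delay_early// mul0r. Qed.

Lemma ess_width u t : 0 <= Num.min (ess_shift t) (depth u) <= depth u.
Proof. by rewrite ge_min lexx orbT andbT le_min ess_shift_ge0 bary_min_ge0. Qed.

Lemma ess_width_lt u t : n.+1%:R * Num.min (ess_shift t) (depth u) < 1.
Proof.
by apply: le_lt_trans (ess_shift_lt t); rewrite ler_wpM2l// ge_min lexx.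
Qed.

Lemma ess_move_bdry u t : depth u <= ess_shift t -> bdry xpredT (ess_move u t).
Proof.
move=> dv; rewrite /ess_move min_r//; apply: shrink_bdry.
by have := ess_width_lt u t; rewrite min_r.
Qed.

Lemma ess_move_early u t : t <= stage_time n -> ess_move u t = u.
Proof. by move=> ta; rewrite /ess_move ess_shift_early// min_l ?bary_min_ge0// shrink0. Qed.

Lemma ess_move_bdryE u t : bdry xpredT u -> ess_move u t = u.
Proof.
by move=> /bary_min_bdry m0; rewrite /ess_move m0 min_r ?ess_shift_ge0// shrink0.
Qed.

Lemma ess_time_exit u t : ess_shift t = depth u -> ess_time u t = stage_time n.
Proof.
rewrite /ess_time => <-; rewrite /ess_shift; field.
by rewrite nat1r pnatr_eq0 /= gt_eqF// delay1_gt0.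
Qed.

Lemma ess_shift_continuous : continuous ess_shift.
Proof.
apply: contM; first exact: delay_continuous.
apply: contV => [t|].
  by rewrite mulf_neq0 ?pnatr_eq0// gt_eqF// delay1_gt0.
apply: contM; last exact: cst_continuous.
by apply: contD; [exact: cst_continuous|exact: delay_continuous].
Qed.

Lemma ess_move_continuous : continuous (fun p : Delta n * R => ess_move p.1 p.2).
Proof.
apply: shrink_continuous.
- apply: cont_min; first exact: cont_comp (@snd_continuous _ _) ess_shift_continuous.
  exact: cont_comp (@fst_continuous _ _) (@bary_min_continuous _ _ _).
- exact: fst_continuous.
- by move=> p; exact: ess_width.
- by move=> p; exact: ess_width_lt.
Qed.

Lemma ess_time_continuous : continuous (fun p : Delta n * R => ess_time p.1 p.2).
Proof.
have dc := cont_comp (@snd_continuous (Delta n) R) (@delay_continuous R n).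
have mc := cont_comp (@fst_continuous (Delta n) R) (@bary_min_continuous R n xpredT).
apply: contD; first by apply: contD => //; exact: cst_continuous.
apply: contN; apply: contM; last by apply: contD => //; exact: cst_continuous.
by apply: contM => //; exact: cst_continuous.
Qed.

End essential_move.

Section redundant_move.
Variables (n : nat) (k0 : 'I_n.+2).
Implicit Types (u : Delta n.+1) (t : R).
Local Notation depth u := (bary_min (predC1 k0) u).

(** The factor [1 + depth] makes the push end strictly before the end of the slot,
    whatever the depth, while points of the horn have no push to make. *)
Definition red_shift u t : R := (1 + depth u) * slot n t.

Definition red_move u t : Delta n.+1 := push k0 (Num.min (red_shift u t) (depth u)) u.

(** The horn is itself moving during the slot if it contains other redundant
    cells.  A point arriving on it late starts at the beginning of the slot
    ([red_time_exit]), is then sped up, and is synchronous again when the slot ends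
    ([red_time_late]).  On the horn itself the time is not changed. *)
Definition red_time u t : R := t - depth u * (1 - slot n t) * stage_time n.+1.

Lemma red_shift_ge0 u t : 0 <= red_shift u t.
Proof. by rewrite mulr_ge0 ?slot_ge0// addr_ge0 ?bary_min_ge0. Qed.

Lemma red_width u t : 0 <= Num.min (red_shift u t) (depth u) <= depth u.
Proof. by rewrite ge_min lexx orbT andbT le_min red_shift_ge0 bary_min_ge0. Qed.

Lemma red_move_exit u t : depth u <= red_shift u t -> red_move u t = to_horn k0 u.
Proof. by move=> dv; rewrite /red_move min_r. Qed.

Lemma red_shift_early u t : t <= stage_time n.+1 -> red_shift u t = 0.
Proof. by move=> ta; rewrite /red_shift slot_early ?mulr0. Qed.

Lemma red_move_early u t : t <= stage_time n.+1 -> red_move u t = u.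
Proof. by move=> ta; rewrite /red_move red_shift_early// min_l ?bary_min_ge0// push0. Qed.

Lemma red_move_bdry u t : bdry (predC1 k0) u -> red_move u t = u.
Proof.
by move=> /bary_min_bdry m0; rewrite /red_move m0 min_r -?[leRHS]m0 ?red_shift_ge0 ?push0.
Qed.

Lemma red_shift_late u t : stage_time n <= t -> depth u < red_shift u t.
Proof. by move=> ta; rewrite /red_shift slot_late// mulr1 ltrDr. Qed.

Lemma red_time_late u t : stage_time n <= t -> red_time u t = t.
Proof. by move=> ta; rewrite /red_time slot_late// subrr mulr0 mul0r subr0. Qed.

Lemma red_time_le u t : red_time u t <= t.
Proof.
rewrite lerBlDr lerDl !mulr_ge0 ?bary_min_ge0 ?subr_ge0 ?slot_le1//.
by rewrite ltW// stage_time_gt0.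
Qed.

Lemma red_time_exit u t : red_shift u t = depth u -> red_time u t <= stage_time n.+1.
Proof.
have a0 := stage_time_gt0 R n.+1; have := bary_min_ge0 (predC1 k0) u.
rewrite /red_shift => d0 vd.
have [ta|ta] := leP t (stage_time n.+1); first exact: le_trans (red_time_le u t) ta.
have s0 := slot_gt0 ta; move: (slot_le1 n t); rewrite le_eqVlt => /orP[/eqP s1|s1].
  by move: vd; rewrite s1; lra.
rewrite /red_time [in X in X - _](@slot_between R n t) ?s0//.
have -> : bary_min (predC1 k0) u * (1 - slot n t) = slot n t.
  by rewrite mulrBr mulr1 -{1}vd; ring.
by rewrite mulrDr mulr1 mulrC addrK.
Qed.

Lemma red_shift_continuous : continuous (fun p : Delta n.+1 * R => red_shift p.1 p.2).
Proof.
have sc := cont_comp (@snd_continuous (Delta n.+1) R) (@slot_continuous R n).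
have mc := cont_comp (@fst_continuous (Delta n.+1) R)
  (@bary_min_continuous R n.+1 (predC1 k0)).
by apply: contM => //; apply: contD => //; exact: cst_continuous.
Qed.

Lemma red_move_continuous : continuous (fun p : Delta n.+1 * R => red_move p.1 p.2).
Proof.
apply: push_continuous.
- apply: cont_min; first exact: red_shift_continuous.
  exact: cont_comp (@fst_continuous _ _) (@bary_min_continuous _ _ _).
- exact: fst_continuous.
- by move=> p; exact: red_width.
Qed.

Lemma red_time_continuous : continuous (fun p : Delta n.+1 * R => red_time p.1 p.2).
Proof.
have sc := cont_comp (@snd_continuous (Delta n.+1) R) (@slot_continuous R n).
have mc := cont_comp (@fst_continuous (Delta n.+1) R)
  (@bary_min_continuous R n.+1 (predC1 k0)).
apply: contD; first exact: snd_continuous.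
apply: contN; apply: contM; last exact: cst_continuous.
apply: contM => //; apply: contD; first exact: cst_continuous.
exact: contN.
Qed.

Lemma to_horn_continuous : continuous (@to_horn R n k0).
Proof.
apply: push_continuous; first exact: bary_min_continuous.
  by move=> ?; exact: cvg_id.
by move=> u; rewrite bary_min_ge0 lexx.
Qed.

End redundant_move.

Lemma flow_exists : exists f : X -> R -> X,
  (forall n (e : K n) (u : Delta n), essential S e -> inside u ->
     forall t, f (chi e u) t = if ess_shift n t <= bary_min xpredT u
       then chi e (ess_move u t) else f (chi e (ess_move u t)) (ess_time u t)) /\
  (forall n (c : K n) (u : Delta n.+1), redundant S c ->
     inner (predC1 (imap S c)) u ->
     forall t, f (chi (cmap S c) u) t =
       if red_shift (imap S c) u t <= bary_min (predC1 (imap S c)) u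
       then chi (cmap S c) (red_move (imap S c) u t)
       else f (chi (cmap S c) (to_horn (imap S c) u)) (red_time (imap S c) u t)).
Proof.
pose PE n (e : K n) (u : Delta n) (phi : Delta n -> R -> X) : R -> X := fun t =>
  if ess_shift n t <= bary_min xpredT u
  then chi e (ess_move u t) else phi (ess_move u t) (ess_time u t).
pose PR n (c : K n) (u : Delta n.+1) (phi : Delta n.+1 -> R -> X) : R -> X := fun t =>
  if red_shift (imap S c) u t <= bary_min (predC1 (imap S c)) u
  then chi (cmap S c) (red_move (imap S c) u t)
  else phi (to_horn (imap S c) u) (red_time (imap S c) u t).
have [|||f [fE fR]] := @point_recursion R K S (R -> X) PE PR.
- move=> n e u phi phi' pp'; apply/funext => t; rewrite /PE; case: leP => // mv.
  by rewrite pp'//; apply: ess_move_bdry; exact: ltW.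
- move=> n e u phi phi' pp'; apply/funext => t; rewrite /PR; case: leP => // mv.
  by rewrite pp'//; exact: to_horn_in_bdry.
- by move=> p _; exact: p.
exists f; split=> n x u xS ui t; first by rewrite fE.
by rewrite fR.
Qed.

Definition flow : X -> R -> X := sval (cid flow_exists).

Lemma flow_inner_essential n (e : K n) (u : Delta n) t : essential S e -> inside u ->
  flow (chi e u) t = if ess_shift n t <= bary_min xpredT u
    then chi e (ess_move u t) else flow (chi e (ess_move u t)) (ess_time u t).
Proof. by rewrite /flow; case: cid => f /= [fE _] ? ?; exact: fE. Qed.

Lemma flow_inner_redundant n (c : K n) (u : Delta n.+1) t : redundant S c ->
  inner (predC1 (imap S c)) u ->
  flow (chi (cmap S c) u) t =
    if red_shift (imap S c) u t <= bary_min (predC1 (imap S c)) u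
    then chi (cmap S c) (red_move (imap S c) u t)
    else flow (chi (cmap S c) (to_horn (imap S c) u)) (red_time (imap S c) u t).
Proof. by rewrite /flow; case: cid => f /= [_ fR] ? ?; exact: fR. Qed.

(** Since the slots of lower stages come later, points of an [n]-simplex rest
    until the slot of stage [n] opens; this is what makes both clauses of the flow
    agree with the boundary values at the moment of exit. *)
Lemma flow_early n (x : K n) (u : Delta n) t : t <= stage_time n.+1 ->
  flow (chi x u) t = chi x u.
Proof.
pose P n (x : K n) := forall (u : Delta n) t, t <= stage_time n.+1 ->
  flow (chi x u) t = chi x u.
suff PX : forall n (x : K n), True -> P n x by exact: PX.
move=> {n x u t}; apply: (simplex_ind (S := S)) => //.
- move=> n j y Py u t ta; rewrite chi_degen Py//.
  exact: le_trans ta (stage_time_leS _ _).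
- move=> n e _ eE Pe u t ta; have tn := le_trans ta (stage_time_leS _ _).
  have [ui|ub] := inner_or_bdry xpredT u.
    by rewrite flow_inner_essential// ess_shift_early// bary_min_ge0 ess_move_early.
  pose Q p := forall t, t <= stage_time n -> flow p t = p.
  apply: (@chi_bdry_essential R K Q n e _ u ub t tn).
  by move: Pe; rewrite {}/Q; clear; case: n e => // n e Pe j u t; exact: Pe.
- move=> n c _ cR Pc.
  have Qc (u : Delta n.+1) t : t <= stage_time n.+1 ->
      flow (chi (cmap S c) u) t = chi (cmap S c) u.
    move=> ta; have [ui|ub] := inner_or_bdry (predC1 (imap S c)) u.
      by rewrite flow_inner_redundant// red_shift_early// bary_min_ge0 red_move_early.
    pose Q p := forall t, t <= stage_time n.+1 -> flow p t = p.
    by apply: (@chi_bdry_redundant R K S Q n c _ u ub t ta) => j ji v s; exact: Pc.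
  split=> u t ta; first by rewrite (chi_redundant u cR) Qc.
  by apply: Qc; exact: le_trans ta (stage_time_leS _ _).
Qed.

Lemma flow_bdry_essential n (e : K n) (u : Delta n) t : bdry xpredT u ->
  t <= stage_time n -> flow (chi e u) t = chi e u.
Proof.
case: n e u => [|n] e u [k _ uk] ta; first by move/eqP: uk; rewrite bary0 oner_eq0.
by have [w ->] := cofaceP uk; rewrite -chi_face flow_early.
Qed.

Lemma flow_bdry_redundant n (c : K n) (u : Delta n.+1) t :
  bdry (predC1 (imap S c)) u -> t <= stage_time n.+1 ->
  flow (chi (cmap S c) u) t = chi (cmap S c) u.
Proof.
by move=> [k _ uk] ta; have [w ->] := cofaceP uk; rewrite -chi_face flow_early.
Qed.

(** The clause also holds on the boundary of the cell: there the motion is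
    trivial and the corrected time is the true one, apart from early times, when the
    boundary rests anyway. *)
Lemma flow_essential n (e : K n) (u : Delta n) t : essential S e ->
  flow (chi e u) t = if ess_shift n t <= bary_min xpredT u
    then chi e (ess_move u t) else flow (chi e (ess_move u t)) (ess_time u t).
Proof.
move=> eE; have [ui|ub] := inner_or_bdry xpredT u; first exact: flow_inner_essential.
rewrite ess_move_bdryE// /ess_time (bary_min_bdry ub) mulr0 mul0r subr0.
have [ta|ta] := leP t (stage_time n).
  by rewrite ess_shift_early// lexx flow_bdry_essential.
rewrite delay_late ?(ltW ta)// addrC subrK.
case: leP => // v0; have : ess_shift n t = 0.
  by apply/le_anti; rewrite v0 ess_shift_ge0.
move/eqP; rewrite mulf_eq0 invr_eq0 delay_late ?(ltW ta)// subr_eq0 gt_eqF//=.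
by rewrite mulf_eq0 pnatr_eq0 orbF -(delay_late (ltW ta)) gt_eqF// delay1_gt0.
Qed.

Lemma flow_redundant n (c : K n) (u : Delta n.+1) t : redundant S c ->
  flow (chi (cmap S c) u) t =
    if red_shift (imap S c) u t <= bary_min (predC1 (imap S c)) u
    then chi (cmap S c) (red_move (imap S c) u t)
    else flow (chi (cmap S c) (red_move (imap S c) u t)) (red_time (imap S c) u t).
Proof.
move=> cR; have [ui|ub] := inner_or_bdry (predC1 (imap S c)) u.
  rewrite flow_inner_redundant//; case: leP => // vm.
  by rewrite red_move_exit// ltW.
rewrite red_move_bdry// /red_time /red_shift (bary_min_bdry ub) !mul0r subr0 addr0 mul1r.
case: leP => // s0; apply: flow_bdry_redundant => //.
by rewrite leNgt; apply/negP => /slot_gt0; rewrite ltNge s0.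
Qed.

Lemma flow_start p t : t <= 0 -> flow p t = p.
Proof.
move=> t0; have [n [x [u ->]]] := chi_surj p; apply: flow_early.
by rewrite (le_trans t0)// ltW// stage_time_gt0.
Qed.

Lemma flow_continuous : continuous (fun p : X * R => flow p.1 p.2).
Proof.
apply: (@final_homotopy_continuous R X _ _ _ X _ (realisation_final R K)).
move=> [n x] /=; apply: (@simplexwise_continuous R K S X (fun=> True) flow) => //.
- move=> {x}m e _ eE hc.
  rewrite (_ : (fun _ => _) = fun p : Delta m * R =>
      if ess_shift m p.2 <= bary_min xpredT p.1
      then chi e (ess_move p.1 p.2)
      else flow (chi e (ess_move p.1 p.2)) (ess_time p.1 p.2)); last first.
    by apply/funext => p; exact: flow_essential.
  apply: (@glue_continuous R _ _ (fun p => ess_shift m p.2)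
    (fun p => bary_min xpredT p.1) (fun p => ess_time p.1 p.2)
    (fun p => ess_move p.1 p.2) (chi e)
    (fun p : Delta m * R => flow (chi e p.1) p.2) (bdry xpredT)) => //.
  + exact: cont_comp (@snd_continuous _ _) (@ess_shift_continuous m).
  + exact: cont_comp (@fst_continuous _ _) (@bary_min_continuous _ _ _).
  + exact: ess_time_continuous.
  + exact: ess_move_continuous.
  + exact: chi_continuous.
  + by move=> p; exact: ess_move_bdry.
  + move=> p vm /=; rewrite ess_time_exit// flow_bdry_essential//.
    by apply: ess_move_bdry; rewrite vm.
- move=> {x}m c _ cR hc.
  rewrite (_ : (fun _ => _) = fun p : Delta m.+1 * R =>
    if red_shift (imap S c) p.1 p.2 <= bary_min (predC1 (imap S c)) p.1
    then chi (cmap S c) (red_move (imap S c) p.1 p.2)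
    else flow (chi (cmap S c) (red_move (imap S c) p.1 p.2))
      (red_time (imap S c) p.1 p.2)); last first.
    by apply/funext => p; exact: flow_redundant.
  apply: (@glue_continuous R _ _ (fun p => red_shift (imap S c) p.1 p.2)
    (fun p => bary_min (predC1 (imap S c)) p.1)
    (fun p => red_time (imap S c) p.1 p.2)
    (fun p => red_move (imap S c) p.1 p.2) (chi (cmap S c))
    (fun p : Delta m.+1 * R => flow (chi (cmap S c) p.1) p.2)
    (bdry (predC1 (imap S c)))) => //.
  + exact: red_shift_continuous.
  + exact: cont_comp (@fst_continuous _ _) (@bary_min_continuous _ _ _).
  + exact: red_time_continuous.
  + exact: red_move_continuous.
  + exact: chi_continuous.
  + by move=> p mv; rewrite red_move_exit//; exact: to_horn_in_bdry.
  + move=> p vm /=; rewrite flow_bdry_redundant//; last exact: red_time_exit.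
    by rewrite red_move_exit ?vm//; exact: to_horn_in_bdry.
Qed.

Local Notation collapse := (@collapse R K S).

(** Until the end of the slot of stage [n], points of [n]-simplices move only
    along pushing lines, which [collapse] contracts. *)
Lemma collapse_flow_early n (x : K n) (u : Delta n) t : t <= stage_time n ->
  collapse (flow (chi x u) t) = collapse (chi x u).
Proof.
pose P n (x : K n) := forall (u : Delta n) t, t <= stage_time n ->
  collapse (flow (chi x u) t) = collapse (chi x u).
suff PX : forall n (x : K n), True -> P n x by exact: PX.
move=> {n x u t}; apply: (simplex_ind (S := S)) => //.
- move=> n j y Py u t ta; rewrite chi_degen Py//.
  exact: le_trans ta (stage_time_leS _ _).
- move=> n e _ eE _ u t ta; have [ui|ub] := inner_or_bdry xpredT u.
    by rewrite flow_inner_essential// ess_shift_early// bary_min_ge0 ess_move_early.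
  by rewrite flow_bdry_essential.
- move=> n c _ cR Pc.
  have Qc (u : Delta n.+1) t : t <= stage_time n ->
      collapse (flow (chi (cmap S c) u) t) = collapse (chi (cmap S c) u).
    pose Q p := forall t, t <= stage_time n -> collapse (flow p t) = collapse p.
    have Qb (v : Delta n.+1) : bdry (predC1 (imap S c)) v -> Q (chi (cmap S c) v).
      by apply: chi_bdry_redundant => j ji w s; exact: Pc.
    move=> ta; rewrite flow_redundant//; case: leP => vm.
      by rewrite /red_move collapse_push//; exact: red_width.
    rewrite red_move_exit ?ltW// Qb; last exact: le_trans (red_time_le _ _ _) ta.
      by rewrite -collapse_redundant.
    exact: to_horn_in_bdry.
  split=> u t ta; first by rewrite (chi_redundant u cR) Qc.
  by apply: Qc; exact: le_trans ta (stage_time_leS _ _).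
Qed.

Lemma collapse_flow_horn n (c : K n) (v : Delta n.+1) t :
  bdry (predC1 (imap S c)) v -> t <= stage_time n ->
  collapse (flow (chi (cmap S c) v) t) = collapse (chi (cmap S c) v).
Proof.
by move=> [k _ uk] ta; have [w ->] := cofaceP uk; rewrite -chi_face collapse_flow_early.
Qed.

(** From the end of its slot on, a point has caught up with the point of the horn
    to which it was pushed. *)
Lemma flow_late_redundant n (c : K n) (u : Delta n.+1) t : redundant S c ->
  stage_time n <= t ->
  flow (chi (cmap S c) u) t = flow (chi (cmap S c) (to_horn (imap S c) u)) t.
Proof.
move=> cR ta; have vm := red_shift_late (imap S c) u ta.
by rewrite flow_redundant// leNgt vm/= red_move_exit ?ltW// red_time_late.
Qed.

(** This is where the slots are essential: before the end of the slot of stage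
    [n] both sides are the collapse of the starting point, and afterwards the point
    and its image in the horn move together. *)
Lemma collapse_flow p t : collapse (flow (collapse p) t) = collapse (flow p t).
Proof.
elim/(@point_ind R K S): p => n x u xS ui IH; first by rewrite collapse_essential.
have hb := to_horn_in_bdry (imap S x) u.
rewrite collapse_redundant// IH//; have [ta|ta] := leP t (stage_time n); last first.
  by rewrite [in RHS]flow_late_redundant ?ltW.
rewrite collapse_flow_horn// flow_redundant//; case: leP => vm.
  by rewrite /red_move collapse_push -?collapse_redundant//; exact: red_width.
rewrite red_move_exit ?ltW// collapse_flow_horn//.
exact: le_trans (red_time_le _ _ _) ta.
Qed.

Lemma flow1_collapse p : flow (collapse p) 1 = flow p 1.
Proof.
elim/(@point_ind R K S): p => n x u xS ui IH; first by rewrite collapse_essential.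
rewrite collapse_redundant// IH; last exact: to_horn_in_bdry.
by rewrite -flow_late_redundant// stage_time_le1.
Qed.

End flow.

(** * The ball and the simplex *)
Section radial.
Variables (R : realType) (N : nat).
Local Notation V := 'rV[R]_N.

(** A norm-like function that need not be symmetric.  The bound on coordinates
    gives definiteness and controls the radial homeomorphism at the origin. *)
Record gauge := Gauge {
  gauge_fun :> V -> R;
  gauge_continuous : continuous gauge_fun;
  gaugeZ : forall c (z : V), 0 <= c -> gauge_fun (c *: z) = c * gauge_fun z;
  gauge_coord : forall (z : V) j, `|z ord0 j| <= gauge_fun z;
  gauge_ge0 : forall z : V, 0 <= gauge_fun z
}.

Implicit Types G : gauge.

Lemma gauge0 G : G 0 = 0.
Proof. by rewrite -(scale0r 0) gaugeZ// mul0r. Qed.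

Lemma gauge_eq0 G z : G z = 0 -> z = 0.
Proof.
move=> Gz; apply/rowP => j; rewrite mxE; apply/normr0_eq0/le_anti.
by rewrite normr_ge0 -Gz gauge_coord.
Qed.

(** The homeomorphism that maps each ball of [G1] onto the ball of [G2] of the same
    radius, along rays. *)
Definition radial G1 G2 (z : V) : V := (G1 z / G2 z) *: z.

Lemma gauge_radial G1 G2 z : G2 (radial G1 G2 z) = G1 z.
Proof.
rewrite /radial gaugeZ ?divr_ge0 ?gauge_ge0//.
have [G2z|G2z] := eqVneq (G2 z) 0; last by rewrite divfK.
by rewrite (gauge_eq0 G2z) !gauge0 mulr0.
Qed.

Lemma radialK G1 G2 : cancel (radial G1 G2) (radial G2 G1).
Proof.
move=> z; rewrite {1}/radial gauge_radial.
have [z0|z0] := eqVneq z 0; first by rewrite z0 /radial !scaler0.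
have G10 : G1 z != 0 by apply: contraNneq z0 => /gauge_eq0 ->.
have G20 : G2 z != 0 by apply: contraNneq z0 => /gauge_eq0 ->.
rewrite /radial gaugeZ ?divr_ge0 ?gauge_ge0// scalerA -[RHS]scale1r.
by congr (_ *: _); field; rewrite G10 G20.
Qed.

(** Away from the origin this is algebra; at the origin each coordinate is
    bounded by [G1], by [gauge_coord] for [G2]. *)
Lemma radial_continuous G1 G2 : continuous (radial G1 G2).
Proof.
apply: into_mx_continuous => i j; rewrite (ord1 i) => {i}.
rewrite (_ : (fun _ => _) = fun z => G1 z / G2 z * z ord0 j); last first.
  by apply/funext => z; rewrite mxE.
move=> z; have [z0|z0] := eqVneq z 0; last first.
  have G20 : G2 z != 0 by apply: contraNneq z0 => /gauge_eq0 ->.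
  have G2c := continuousV G20 (@gauge_continuous G2 z).
  have Gc := continuousM (@gauge_continuous G1 z) G2c.
  exact: (continuousM Gc (@mx_coord_continuous _ _ _ ord0 j z)).
rewrite /continuous_at z0 mxE mulr0.
apply: (@squeeze_cvgr _ (nbhs (0 : V)) (nbhs_filter _) R (fun z => - G1 z) G1).
- apply: filterE => y; rewrite -ler_norml normrM ger0_norm ?divr_ge0 ?gauge_ge0//.
  have [G2y|G2y] := eqVneq (G2 y) 0; first by rewrite G2y invr0 mulr0 mul0r gauge_ge0.
  rewrite -mulrA ler_piMr ?gauge_ge0// mulrC ler_pdivrMr ?mul1r ?gauge_coord//.
  by rewrite lt_neqAle eq_sym G2y gauge_ge0.
- have := contN (@gauge_continuous G1) (x := 0).
  by rewrite /continuous_at gauge0 oppr0; exact.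
- by have := @gauge_continuous G1 0; rewrite /continuous_at gauge0; exact.
Qed.

Definition norm2 (z : V) : R := Num.sqrt (\sum_k z ord0 k ^+ 2).

Lemma norm2_continuous : continuous norm2.
Proof.
apply: (@cont_comp _ _ _ (fun z : V => \sum_k z ord0 k ^+ 2)).
  apply: cont_sum => k; under eq_fun do rewrite expr2.
  by apply: contM; exact: mx_coord_continuous.
exact: sqrt_continuous.
Qed.

Lemma sumsq_ge0 (z : V) : 0 <= \sum_k z ord0 k ^+ 2.
Proof. by apply: sumr_ge0 => k _; exact: sqr_ge0. Qed.

Lemma norm2Z c (z : V) : 0 <= c -> norm2 (c *: z) = c * norm2 z.
Proof.
move=> c0; rewrite /norm2; under eq_bigr do rewrite mxE exprMn.
by rewrite -mulr_sumr sqrtrM ?sqr_ge0// sqrtr_sqr ger0_norm.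
Qed.

Lemma norm2_coord (z : V) j : `|z ord0 j| <= norm2 z.
Proof.
rewrite -sqrtr_sqr ler_wsqrtr// (bigD1 j)//= lerDl.
by apply: sumr_ge0 => k _; exact: sqr_ge0.
Qed.

Definition euclid : gauge :=
  Gauge norm2_continuous norm2Z norm2_coord (fun z => sqrtr_ge0 _).

Lemma norm2_le1 (z : V) : (norm2 z <= 1) = (\sum_k z ord0 k ^+ 2 <= 1).
Proof. by rewrite -[X in _ <= X]sqrtr1 ler_sqrt. Qed.

Lemma norm2_eq1 (z : V) : norm2 z = 1 <-> \sum_k z ord0 k ^+ 2 = 1.
Proof.
split=> [n1|s1]; last by rewrite /norm2 s1 sqrtr1.
by rewrite -[LHS]sqr_sqrtr ?sumsq_ge0// -/(norm2 z) n1 expr1n.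
Qed.

(** Vectors of dimension [N] stand for vectors of [N + 1] coordinates with sum zero;
    the last coordinate is determined by the others. *)
Definition tangent (z : V) (k : 'I_N.+1) : R :=
  if unlift ord_max k is Some j then z ord0 j else - \sum_j z ord0 j.

Lemma tangent_lift z j : tangent z (lift ord_max j) = z ord0 j.
Proof. by rewrite /tangent liftK. Qed.

Lemma tangent_last z : tangent z ord_max = - \sum_j z ord0 j.
Proof. by rewrite /tangent unlift_none. Qed.

Lemma tangent_sum z : \sum_k tangent z k = 0.
Proof.
rewrite (bigD1_ord ord_max)//= tangent_last.
by under eq_bigr do rewrite tangent_lift; rewrite addNr.
Qed.

Lemma tangentZ c z k : tangent (c *: z) k = c * tangent z k.
Proof.
rewrite /tangent; case: unlift => [j|]; first by rewrite mxE.
by rewrite mulrN mulr_sumr; congr (- _); apply: eq_bigr => j _; rewrite mxE.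
Qed.

Lemma tangent_continuous k : continuous (tangent^~ k).
Proof.
rewrite /tangent; case: unlift => [j|]; first exact: mx_coord_continuous.
by apply: contN; apply: cont_sum => j; exact: mx_coord_continuous.
Qed.

(** The gauge whose unit ball is the standard simplex, moved so that its
    barycentre is at the origin: [1 - sgauge] is [N + 1] times the smallest
    barycentric coordinate ([sgauge_offset]). *)
Definition sgauge (z : V) : R := N.+1%:R * \big[Num.max/0]_k - tangent z k.

Lemma sgauge_continuous : continuous sgauge.
Proof.
apply: contM; first exact: cst_continuous.
rewrite (_ : (fun _ => _) = fun z => - \big[Num.min/0]_k tangent z k); last first.
  apply/funext => z; elim/big_rec2: _ => [|k x y _ ->]; first by rewrite oppr0.
  by rewrite oppr_min.
by apply: contN; apply: cont_bigmin => k; exact: tangent_continuous.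
Qed.

Lemma sgauge_ge0 z : 0 <= sgauge z.
Proof. by rewrite mulr_ge0//; exact: bigmax_ge_id. Qed.

Lemma sgauge_tangent z k : - tangent z k <= sgauge z / N.+1%:R.
Proof.
rewrite /sgauge mulrC mulKf ?pnatr_eq0//.
exact: (@le_bigmax _ _ _ 0 (fun k => - tangent z k)).
Qed.

Lemma sgauge_coord (z : V) j : `|z ord0 j| <= sgauge z.
Proof.
have N0 : 0 < N.+1%:R^-1 :> R by rewrite invr_gt0.
have N1 : N.+1%:R^-1 <= 1 :> R by rewrite invf_le1// ler1n.
have s0 := sgauge_ge0 z; rewrite -tangent_lift ler_norml; apply/andP; split.
  rewrite lerNl; apply: (le_trans (sgauge_tangent _ _)).
  by rewrite ler_piMr.
have := tangent_sum z; rewrite (bigD1 (lift ord_max j))//= => /eqP.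
rewrite addr_eq0 => /eqP ->; rewrite -sumrN.
apply: (@le_trans _ _ (\sum_(k < N.+1 | k != lift ord_max j) (sgauge z / N.+1%:R))).
  by apply: ler_sum => k _; exact: sgauge_tangent.
rewrite sumr_const -[(_ / _) *+ _]mulr_natr -mulrA ler_piMr// mulrC ler_pdivrMr// mul1r ler_nat.
by rewrite -[leqRHS](card_ord N.+1) max_card.
Qed.

Lemma sgaugeZ c z : 0 <= c -> sgauge (c *: z) = c * sgauge z.
Proof.
move=> c0; rewrite /sgauge mulrCA; congr (_ * _).
elim/big_rec2: _ => [|k x y _ ->]; first by rewrite mulr0.
by rewrite tangentZ -mulrN maxr_pMr.
Qed.

Definition simplicial : gauge :=
  Gauge sgauge_continuous sgaugeZ sgauge_coord sgauge_ge0.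

Local Notation b := (N.+1%:R^-1 : R).
Local Notation Delta := (std_simplex R).

Definition around_center (z : V) (k : 'I_N.+1) : R := b + tangent z k.

Lemma around_center_bary z : sgauge z <= 1 -> barycentric (around_center z).
Proof.
move=> z1; split=> [k|].
  rewrite -[leRHS]opprK oppr_ge0 /around_center opprD addrC subr_le0.
  apply: (le_trans (sgauge_tangent z k)).
  by rewrite ler_piMl ?invr_ge0.
rewrite big_split/= tangent_sum addr0 sumr_const card_ord -[b *+ _]mulr_natl divff//.
by rewrite pnatr_eq0.
Qed.

Lemma radial_disk_le1 (y : unit_disk R N) :
  sgauge (radial euclid simplicial (\val y)) <= 1.
Proof.
rewrite -[sgauge _]/(simplicial _) gauge_radial /= norm2_le1.
exact: (set_valP y).
Qed.

Definition disk_to_simplex (y : unit_disk R N) : Delta N :=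
  simplex_of (around_center_bary (radial_disk_le1 y)).1
             (around_center_bary (radial_disk_le1 y)).2.

Lemma bary_disk_to_simplex y k :
  bary (disk_to_simplex y) k = b + tangent (radial euclid simplicial (\val y)) k.
Proof. exact: bary_simplex_of. Qed.

Lemma disk_to_simplex_continuous : continuous disk_to_simplex.
Proof.
apply: into_simplex_continuous => k; under eq_fun do rewrite bary_disk_to_simplex.
apply: contD; first exact: cst_continuous.
apply: cont_comp (@tangent_continuous k).
apply: cont_comp (@radial_continuous _ _); exact: val_continuous.
Qed.

Definition offset (u : Delta N) : V := \row_j (bary u (lift ord_max j) - b).

Lemma tangent_offset u k : tangent (offset u) k = bary u k - b.
Proof.
have [j ->|->] := unliftP ord_max k; first by rewrite tangent_lift mxE.
rewrite tangent_last; under eq_bigr do rewrite mxE.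
have := bary_sum u; rewrite (bigD1_ord ord_max)//= => /eqP; rewrite eq_sym -subr_eq.
rewrite sumrB sumr_const card_ord => /eqP <-; rewrite -[b *+ N]mulr_natr.
have N1 : b * N%:R = 1 - b.
  by apply/eqP; rewrite eq_sym subr_eq -{2}[b]mulr1 -mulrDr natr1 mulVf// pnatr_eq0.
by rewrite N1; ring.
Qed.

Lemma sgauge_offset u : sgauge (offset u) = 1 - N.+1%:R * bary_min xpredT u.
Proof.
have N0 : 0 < N.+1%:R :> R by [].
have [|k _ mk] := @bary_min_attained R N xpredT u; first by exists ord0.
apply/le_anti/andP; split.
  rewrite /sgauge -[leRHS](mulVKf (lt0r_neq0 N0)) ler_wpM2l ?(ltW N0)//.
  apply: bigmax_le.
    by rewrite mulr_ge0 ?invr_ge0 ?(ltW N0)// subr_ge0 bary_min_mean.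
  move=> l _; rewrite tangent_offset opprB mulrBr mulr1 mulKf ?lt0r_neq0//.
  by rewrite lerB// bary_min_le.
have := sgauge_tangent (offset u) k.
rewrite tangent_offset opprB -mk ler_pdivlMr// mulrBl mulVf ?lt0r_neq0//.
by rewrite mulrC.
Qed.

Lemma simplex_to_disk_subproof (u : Delta N) :
  radial simplicial euclid (offset u) \in unit_disk R N.
Proof.
apply/mem_set; rewrite /unit_disk /= -norm2_le1 -[norm2 _]/(euclid _) gauge_radial.
by rewrite /= sgauge_offset gerBl mulr_ge0// bary_min_ge0.
Qed.

Definition simplex_to_disk (u : Delta N) : unit_disk R N :=
  SigSub (simplex_to_disk_subproof u).

Lemma simplex_to_disk_continuous : continuous simplex_to_disk.
Proof.
apply: into_subtype_continuous; apply: cont_comp (@radial_continuous _ _).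
apply: into_mx_continuous => i j; under eq_fun do rewrite mxE.
by apply: contD; [exact: bary_continuous|exact: cst_continuous].
Qed.

Lemma simplex_to_diskK : cancel simplex_to_disk disk_to_simplex.
Proof.
move=> u; apply: bary_inj => k; rewrite bary_disk_to_simplex /= radialK.
by rewrite tangent_offset addrC subrK.
Qed.

Lemma disk_to_simplexK : cancel disk_to_simplex simplex_to_disk.
Proof.
move=> y; apply/val_inj => /=.
rewrite (_ : offset _ = radial euclid simplicial (\val y)) ?radialK//.
by apply/rowP => j; rewrite mxE bary_disk_to_simplex tangent_lift addrC addKr.
Qed.

Lemma bdry_simplex_to_disk (u : Delta N) :
  bdry xpredT u <-> unit_sphere R N (\val (simplex_to_disk u)).
Proof.
rewrite /unit_sphere /= -norm2_eq1 -[norm2 _]/(euclid _) gauge_radial /= sgauge_offset.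
split=> [/bary_min_bdry ->|/eqP]; first by rewrite mulr0 subr0.
rewrite -subr_eq0 addrAC subrr add0r oppr_eq0 mulf_eq0 pnatr_eq0/= => /eqP m0.
have [|k _ mk] := @bary_min_attained R N xpredT u; first by exists ord0.
by exists k; rewrite -?mk.
Qed.

End radial.

(** * The collapsed complex *)
(** [Some n] stands for the [n]-skeleton and [None] for the whole complex, which
    are built in the same way. *)
Definition dim_ok (N : option nat) (k : nat) : bool :=
  if N is Some n then (k <= n)%N else true.

Lemma dim_okS N k : dim_ok N k.+1 -> dim_ok N k.
Proof. by case: N => //= n; exact: ltnW. Qed.

(** The realisation as a bare set, to be given the final topology of the maps
    [collapse \o chi e] for essential [e] of the allowed dimensions.  Putting this
    topology on all of |K|, and not only on the essential points, lets [collapse]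
    be a total map into it. *)
Definition collapsed (R : realType) (K : sset) (S : collapsing_scheme K)
    (N : option nat) : Type := realisation R K.

Section collapsed_topology.
Variables (R : realType) (K : sset) (S : collapsing_scheme K) (N : option nat).
Local Notation Delta := (std_simplex R).
Local Notation collapse := (@collapse R K S).

HB.instance Definition _ := Choice.copy (collapsed R S N) (realisation R K).

Definition collapsed_open (U : set (collapsed R S N)) : Prop :=
  forall k (e : K k), dim_ok N k -> essential S e ->
    open ((fun u : Delta k => collapse (chi e u)) @^-1` U).

Lemma collapsed_openT : collapsed_open setT.
Proof. by move=> k e _ _; rewrite preimage_setT; exact: openT. Qed.

Lemma collapsed_openI : setI_closed collapsed_open.
Proof.
by move=> U V Uo Vo k e kN eE; rewrite preimage_setI; apply: openI;
   [exact: Uo|exact: Vo].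
Qed.

Lemma collapsed_open_bigU (I : Type) (f : I -> set (collapsed R S N)) :
  (forall i, collapsed_open (f i)) -> collapsed_open (\bigcup_i f i).
Proof.
move=> fo k e kN eE; rewrite preimage_bigcup; apply: bigcup_open => i _.
exact: fo.
Qed.

HB.instance Definition _ := @isOpenTopological.Build (collapsed R S N)
  collapsed_open collapsed_openT collapsed_openI collapsed_open_bigU.

Definition essential_points : set (collapsed R S N) := [set p |
  exists k (e : K k) (u : Delta k),
    [/\ dim_ok N k, essential S e, inside u & p = chi e u]].

Lemma collapse_in k (x : K k) (u : Delta k) : dim_ok N k ->
  essential_points (collapse (chi x u)).
Proof.
move=> kN; pose P k (x : K k) := forall u : Delta k,
  essential_points (collapse (chi x u)).
suff PX : forall k (x : K k), dim_ok N k -> P k x by exact: PX.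
move=> {k x u kN}; apply: (simplex_ind (S := S)); first exact: dim_okS.
- by move=> k j y Py u; rewrite chi_degen; exact: Py.
- move=> k e kN eE Pe u; have [ui|ub] := inner_or_bdry xpredT u.
    by rewrite collapse_essential//; exists k, e, u.
  exact: (@chi_bdry_essential R K (fun p => essential_points (collapse p))).
- move=> k t kN tR Pt.
  have Pct (u : Delta k.+1) : essential_points (collapse (chi (cmap S t) u)).
    rewrite collapse_redundant//.
    apply: (@chi_bdry_redundant R K S (fun p => essential_points (collapse p)) k t).
      by move=> j ji v; exact: Pt.
    exact: to_horn_in_bdry.
  by split=> // u; rewrite (chi_redundant u tR).
Qed.

Lemma collapse_id p : essential_points p -> collapse p = p.
Proof. by move=> [k [e [u [_ eE ui ->]]]]; rewrite collapse_essential. Qed.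

(** The topology only mentions essential cells; for the other simplices,
    continuity propagates through horns, because [collapse] factors through
    [to_horn]. *)
Lemma collapse_simplex_continuous k (x : K k) : dim_ok N k ->
  continuous (fun u : Delta k => collapse (chi x u) : collapsed R S N).
Proof.
move=> kN; have : continuous (fun p : Delta k * R =>
    collapse (chi x p.1) : collapsed R S N).
  apply: (@simplexwise_continuous R K S (collapsed R S N) (dim_ok N)
    (fun p _ => collapse p)) => //; first exact: dim_okS.
  - move=> n e nN eE _.
    have ec : continuous (fun u : Delta n => collapse (chi e u) : collapsed R S N).
      by apply/continuousP => U Uo; exact: (Uo n e nN eE).
    exact: cont_comp (@fst_continuous _ _) ec.
  - move=> n t nN tR hc; apply: (@continuous_subspace_setT _ _ _).2.
    rewrite (_ : (fun _ => _) = (fun p : Delta n.+1 * R =>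
        collapse (chi (cmap S t) p.1) : collapsed R S N) \o
        (fun p => (to_horn (imap S t) p.1, p.2))); last first.
      by apply/funext => p /=; exact: collapse_redundant.
    apply: (within_comp _ _ hc).
      apply: continuous_subspaceT; apply: continuous_pair; last exact: snd_continuous.
      exact: cont_comp (@fst_continuous _ _) (@to_horn_continuous _ _ _).
    by move=> p _; split=> //; exact: to_horn_in_bdry.
move=> hc; apply: (@cont_comp _ _ _ (fun u : Delta k => (u, 0 : R)) _ _ hc).
by apply: continuous_pair; [move=> ?; exact: cvg_id|exact: cst_continuous].
Qed.

(** The topology is that of a subspace of [collapsed]; by [morse_final] it is
    also the final topology of the maps [morse_chi]. *)
Definition morse : topologicalType := essential_points : Type.

Definition morse_chi k (x : K k) (kN : dim_ok N k) (u : Delta k) : morse :=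
  SigSub (mem_set (collapse_in x u kN)).

Lemma morse_chi_continuous k (x : K k) (kN : dim_ok N k) : continuous (morse_chi x kN).
Proof. by apply: into_subtype_continuous; exact: collapse_simplex_continuous. Qed.

Lemma morse_point (y : morse) : exists k (e : K k) (u : Delta k) (kN : dim_ok N k),
  [/\ essential S e, inside u & y = morse_chi e kN u].
Proof.
have [k [e [u [kN eE ui ye]]]] := set_valP y; exists k, e, u, kN; split=> //.
by apply/val_inj; rewrite /= collapse_essential.
Qed.

Lemma morse_final : @final_family morse
  {k & {e : K k | dim_ok N k /\ essential S e}} (fun a => Delta (projT1 a))
  (fun a => morse_chi (sval (projT2 a)) (svalP (projT2 a)).1).
Proof.
split=> [y|U Uo].
  have [k [e [u [kN [eE ui ->]]]]] := morse_point y.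
  by exists (existT _ k (exist _ e (conj kN eE))), u; apply/val_inj.
(* The image of [U] is open in [collapsed], as [collapse] takes values in [morse]. *)
exists [set p | exists2 y : morse, U y & \val y = p].
  move=> k e kN eE; have := Uo (existT _ k (exist _ e (conj kN eE))).
  congr (open _); apply/seteqP; split=> u /=.
    by move=> Uu; exists (morse_chi e kN u) => //; move: Uu; congr U; exact/val_inj.
  by move=> [y Uy ye]; move: Uy; congr U; exact/val_inj.
apply/seteqP; split=> y /=; last by move=> Uy; exists y.
by move=> [y' Uy' /val_inj <-].
Qed.

Lemma out_of_morse_continuous (Z : topologicalType) (f : morse -> Z) :
  (forall k (e : K k) (kN : dim_ok N k), essential S e -> continuous (f \o morse_chi e kN)) ->
  continuous f.
Proof.
move=> fc; apply: (final_continuous morse_final) => -[k [e [kN eE]]].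
exact: fc.
Qed.

End collapsed_topology.

Arguments essential_points {R K} S N _ : rename.

Lemma set_type_inj (T : Type) (A : set T) : injective (fun x : A => \val x).
Proof. exact: val_inj. Qed.

(** * Equivariance, cell structure and homotopy equivalence *)
Section equivariance.
Variables (R : realType) (M : monoidType) (K : rigid_msset M)
  (S : collapsing_scheme K) (B : forall n, set (K n)).
Hypothesis eqS : equivariant_scheme S B.
Local Notation Delta := (std_simplex R).
Local Notation act := (@realisation_act R M K).
Local Notation collapse := (@collapse R K S).
Local Notation flow := (@flow R K S).

Lemma act_chi m n (x : K n) (u : Delta n) : act m (chi x u) = chi (sact m x) u.
Proof. exact: realisation_actE. Qed.

Lemma essential_act m n (x : K n) : essential S x -> essential S (sact m x).
Proof.
by move=> xE; have [[+ _] _ _] := equiv_types eqS m (essential_cell xE); exact.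
Qed.

Lemma redundant_act m n (x : K n) : redundant S x -> redundant S (sact m x).
Proof.
by move=> xR; have [_ [+ _] _] := equiv_types eqS m (redundant_cell xR); exact.
Qed.

(** Equivariance of the index is not an axiom, but follows: otherwise the
    translate of [t] would precede itself. *)
Lemma imap_act m n (t : K n) : redundant S t -> imap S (sact m t) = imap S t.
Proof.
move=> tR; apply/eqP; apply: contrapT => /negP it.
apply: (@scheme_wf K S n); exists (fun=> sact m t) => _.
split; [exact: redundant_act|exact: redundant_act|exists (imap S t)].
  by rewrite eq_sym.
by rewrite (equiv_cmap eqS)// -sact_face -scheme_face.
Qed.

Lemma collapse_act m p : collapse (act m p) = act m (collapse p).
Proof.
elim/(@point_ind R K S): p => n x u xS ui IH.
  by rewrite act_chi !collapse_essential ?act_chi//; exact: essential_act.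
rewrite act_chi -(equiv_cmap eqS)// collapse_redundant; last exact: redundant_act.
rewrite imap_act// [in RHS]collapse_redundant// -IH; last exact: to_horn_in_bdry.
by rewrite act_chi (equiv_cmap eqS).
Qed.

Lemma flow_act m p t : flow (act m p) t = act m (flow p t).
Proof.
elim/(@point_ind R K S): p t => n x u xS ui IH t.
  rewrite act_chi flow_essential; last exact: essential_act.
  rewrite [in RHS]flow_essential//; case: leP => xu; first by rewrite act_chi.
  by rewrite -IH ?act_chi//; apply: ess_move_bdry; exact: ltW.
rewrite act_chi -(equiv_cmap eqS)// flow_redundant; last exact: redundant_act.
rewrite imap_act// [in RHS]flow_redundant//.
case: leP => xu; first by rewrite act_chi (equiv_cmap eqS).
rewrite -IH ?act_chi ?(equiv_cmap eqS)//.
by rewrite red_move_exit ?ltW//; exact: to_horn_in_bdry.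
Qed.

Section morse_space.
Variable N : option nat.
Local Notation morse := (@morse R K S N).

Lemma act_in m (y : morse) : essential_points S N (act m (\val y)).
Proof.
have [k [e [u [kN eE ui ->]]]] := set_valP y; rewrite act_chi.
by exists k, (sact m e), u; split=> //; exact: essential_act.
Qed.

Definition morse_act m (y : morse) : morse := SigSub (mem_set (act_in m y)).

Lemma morse_act_chi m k (x : K k) (kN : dim_ok N k) (u : Delta k) :
  morse_act m (morse_chi S x kN u) = morse_chi S (sact m x) kN u.
Proof. by apply: set_type_inj; rewrite /= -collapse_act act_chi. Qed.

Lemma morse_act1 y : morse_act 1%g y = y.
Proof. by apply: set_type_inj; exact: realisation_act1. Qed.

Lemma morse_actM a b y : morse_act (a * b)%g y = morse_act a (morse_act b y).
Proof. by apply: set_type_inj; exact: realisation_actM. Qed.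

Lemma morse_act_continuous :
  continuous (fun p : discrete_topology M * morse => morse_act p.1 p.2).
Proof.
apply: (@discrete_action_continuous M morse morse_act) => m.
apply: out_of_morse_continuous => k e kN eE.
rewrite (_ : _ \o _ = morse_chi S (sact m e) kN); first exact: morse_chi_continuous.
by apply/funext => u; exact: morse_act_chi.
Qed.

Definition morse_mspace : mspace M :=
  MSpace morse_act1 morse_actM morse_act_continuous.

End morse_space.

Lemma widen_in N N' (NN' : forall k, dim_ok N k -> dim_ok N' k)
    (y : morse R S N) : essential_points S N' (\val y).
Proof.
have [k [e [u [kN eE ui ->]]]] := set_valP y.
by exists k, e, u; split=> //; exact: NN'.
Qed.

Definition widen N N' (NN' : forall k, dim_ok N k -> dim_ok N' k)
    (y : morse_mspace N) : morse_mspace N' := SigSub (mem_set (widen_in NN' y)).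

Lemma widen_chi N N' (NN' : forall k, dim_ok N k -> dim_ok N' k) k (x : K k) kN kN'
    (u : Delta k) : widen NN' (morse_chi S x kN u) = morse_chi S x kN' u.
Proof. exact: set_type_inj. Qed.

Lemma widen_mmap N N' (NN' : forall k, dim_ok N k -> dim_ok N' k) :
  is_mmap (widen NN').
Proof.
split=> [|m y]; last exact: set_type_inj.
apply: out_of_morse_continuous => k e kN eE.
rewrite (_ : _ \o _ = morse_chi S e (NN' _ kN)); first exact: morse_chi_continuous.
by apply/funext => u; exact: widen_chi.
Qed.

Lemma widen_inj N N' (NN' : forall k, dim_ok N k -> dim_ok N' k) :
  injective (widen NN').
Proof.
move=> y z yz; apply: set_type_inj.
exact: (congr1 (fun p : morse R S N' => \val p) yz).
Qed.

Section cell_sets.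
Variable n : nat.

Definition cell_act m (e : @essential K S n) : @essential K S n :=
  SigSub (mem_set (essential_act m (set_valP e))).

Lemma cell_act1 e : cell_act 1%g e = e.
Proof. by apply: set_type_inj; exact: sact1. Qed.

Lemma cell_actM a b e : cell_act (a * b)%g e = cell_act a (cell_act b e).
Proof. by apply: set_type_inj; exact: sactM. Qed.

Definition cell_mset : mset M := MSet cell_act1 cell_actM.

Lemma cell_mset_free : free_with_basis (@mact M cell_mset) setT
  ((fun e : cell_mset => \val e : K n) @^-1` (@essential K S n `&` @B n)).
Proof.
have [fE iE sE] := basis_ess eqS n; split=> //.
- move=> [a x] [b y] /set_mem [_ xB] /set_mem [_ yB] /= eab.
  have [-> xy] : (a, \val x) = (b, \val y) :> M * K n.
    apply: iE; [by apply/mem_set|by apply/mem_set|].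
    exact: (congr1 (fun e : @essential K S n => \val e) eab).
  by congr (_, _); exact: set_type_inj.
- move=> e _; have [[a x] [_ [xE xB]] /= axe] := sE _ (set_valP e).
  by exists (a, SigSub (mem_set xE)) => //; apply: set_type_inj.
Qed.

End cell_sets.

Definition cell_of n (p : cell_mset n) : K n := \val p.

Lemma cell_ofE n (p : cell_mset n) : essential S (cell_of p).
Proof. exact: (set_valP p). Qed.

Lemma dim_ok_refl n : dim_ok (Some n) n.
Proof. exact: leqnn. Qed.

Lemma dim_ok_Some n k : dim_ok (Some n) k -> dim_ok (Some n.+1) k.
Proof. exact: leqW. Qed.

Lemma dim_ok_None n k : dim_ok (Some n) k -> dim_ok None k.
Proof. by []. Qed.

Definition skel_incl n : morse_mspace (Some n) -> morse_mspace (Some n.+1) :=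
  widen (@dim_ok_Some n).

Definition skel_inj n : morse_mspace (Some n) -> morse_mspace None :=
  widen (@dim_ok_None n).

Definition point0 : Delta 0 :=
  simplex_of (fun=> ler01) (big_ord1 _ (fun=> 1)).

Lemma point0E (u : Delta 0) : u = point0.
Proof. by apply: bary_inj => k; rewrite !bary0. Qed.

Definition zero_skel (p : discrete_mspace (cell_mset 0)) : morse_mspace (Some 0) :=
  morse_chi S (cell_of p) (dim_ok_refl 0) point0.

Lemma zero_skel_miso : is_miso zero_skel.
Proof.
have inside0 : inside point0 by move=> k _; rewrite bary0 ltr01.
have surj y : exists p, zero_skel p = y.
  have [k [e [u [k0 [eE ui ->]]]]] := morse_point y.
  have kz : k = 0 by apply/eqP; rewrite -leqn0.
  subst k; exists (SigSub (mem_set eE)); apply: set_type_inj.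
  by rewrite [u]point0E.
have inj : injective zero_skel.
  move=> p q /(congr1 (fun y : morse R S (Some 0) => \val y)) /=.
  rewrite !collapse_essential//; try exact: cell_ofE.
  move/(chi_cell_inj (essential_cell (cell_ofE p)) inside0
    (essential_cell (cell_ofE q)) inside0)/simplex_point_inj => [pq _].
  exact: set_type_inj.
have [g gK] := choice surj; have zK : cancel zero_skel g by move=> p; apply: inj.
have zm : is_mmap zero_skel.
  split=> [p U Up|m p]; last by apply: set_type_inj; rewrite /= -collapse_act act_chi.
  apply: (@filterS _ (nbhs (p : discrete_topology (cell_mset 0))) _ [set p]).
    by move=> q ->; exact: nbhs_singleton Up.
  exact: discrete_set1.
split=> //; exists g; split=> //; split=> [|m y]; last first.
  by apply: inj; rewrite gK (zm.2) gK.
apply: out_of_morse_continuous => k e k0 eE.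
have kz : k = 0 by apply/eqP; rewrite -leqn0.
subst k; rewrite (_ : _ \o _ = fun=> g (morse_chi S e k0 point0)).
  exact: cst_continuous.
by apply/funext => u; rewrite /= [u]point0E.
Qed.

Section attaching.
Variable n : nat.
Local Notation disk := (unit_disk R n.+1).
Local Notation sphere := (unit_sphere R n.+1).

Lemma sphere_bdry (s : sphere) :
  bdry xpredT (disk_to_simplex (sphere_incl s)).
Proof. by apply/bdry_simplex_to_disk; rewrite disk_to_simplexK; exact: (set_valP s). Qed.

Lemma attaching_map_in (p : prod_mspace (cell_mset n.+1) sphere) :
  essential_points S (Some n)
    (collapse (chi (cell_of p.1) (disk_to_simplex (sphere_incl p.2)))).
Proof.
have [k _ uk] := sphere_bdry p.2; have [w ->] := cofaceP uk.
by rewrite -chi_face; apply: collapse_in; exact: dim_ok_refl.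
Qed.

Definition attaching_map (p : prod_mspace (cell_mset n.+1) sphere) : morse_mspace (Some n) :=
  SigSub (mem_set (attaching_map_in p)).

Definition cell_map (p : prod_mspace (cell_mset n.+1) disk) : morse_mspace (Some n.+1) :=
  morse_chi S (cell_of p.1) (dim_ok_refl n.+1) (disk_to_simplex p.2).

Lemma skel_incl_attaching_map p : skel_incl (attaching_map p) = cell_map (p.1, sphere_incl p.2).
Proof. exact: set_type_inj. Qed.

Lemma attaching_map_mmap : is_mmap attaching_map.
Proof.
split=> [|m p]; last first.
  by apply: set_type_inj; rewrite /= -collapse_act act_chi.
apply: discrete_prod_continuous => e; apply: into_subtype_continuous.
pose f (v : Delta n.+1 * R) : collapsed R S (Some n) := collapse (chi (cell_of e) v.1).
have fc : {within bdry xpredT `*` setT, continuous f}.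
  apply: (@within_bdry R K (collapsed R S (Some n)) n (cell_of e) xpredT
    (fun p _ => collapse p)) => j _.
  have jc := @collapse_simplex_continuous R K S (Some n) n (face j (cell_of e))
    (dim_ok_refl n).
  exact: cont_comp (@fst_continuous _ _) jc.
have sc : continuous (fun s : sphere => (disk_to_simplex (sphere_incl s), 0 : R)).
  apply: continuous_pair; last exact: cst_continuous.
  apply: cont_comp (@disk_to_simplex_continuous _ _).
  by apply: into_subtype_continuous; exact: val_continuous.
have gc := within_comp (continuous_subspaceT (A := setT) sc)
  (fun s _ => conj (sphere_bdry s) I) fc.
exact: (continuous_subspace_setT _).2 gc.
Qed.

Lemma cell_map_mmap : is_mmap cell_map.
Proof.
split=> [|m p]; last by rewrite /cell_map -morse_act_chi.
apply: discrete_prod_continuous => e.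
exact: cont_comp (@disk_to_simplex_continuous _ _) (@morse_chi_continuous _ _ _ _ _ _ _).
Qed.

Lemma sphere_incl_mmap : is_mmap (fun p : prod_mspace (cell_mset n.+1) sphere =>
  (p.1, sphere_incl p.2) : prod_mspace (cell_mset n.+1) disk).
Proof.
split=> //; apply: continuous_pair; first exact: fst_continuous.
apply: into_subtype_continuous; exact: cont_comp (@snd_continuous _ _) (@val_continuous _ _).
Qed.

Lemma morse_chi_cell_map (e : K n.+1) (eE : essential S e) kN (u : Delta n.+1) :
  morse_chi S e kN u = cell_map (SigSub (mem_set eE), simplex_to_disk u).
Proof. by apply: set_type_inj; rewrite /= simplex_to_diskK. Qed.

Lemma skel_cases (y : morse_mspace (Some n.+1)) :
  (exists z, y = skel_incl z) \/ (exists p, y = cell_map p).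
Proof.
have [k [e [u [kn [eE ui ->]]]]] := morse_point y.
have := kn; rewrite /= leq_eqVlt => /orP[/eqP kn1|kn'].
  by subst k; right; eexists; exact: (morse_chi_cell_map eE).
by left; exists (morse_chi S e (kn' : dim_ok (Some n) k) u); exact: set_type_inj.
Qed.

Lemma sphereP (p : prod_mspace (cell_mset n.+1) disk) :
  inside (disk_to_simplex p.2) \/ exists s, p = (p.1, sphere_incl s).
Proof.
have [?|] := inner_or_bdry xpredT (disk_to_simplex p.2); first by left.
move=> /bdry_simplex_to_disk; rewrite disk_to_simplexK => ps; right.
exists (SigSub (mem_set ps)); case: p ps => e d ps; congr (_, _).
exact: set_type_inj.
Qed.

(** Points of the open cell have dimension [n.+1], so they are not in the
    skeleton below. *)
Lemma cell_map_inside_not_incl p z : inside (disk_to_simplex p.2) -> cell_map p <> skel_incl z.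
Proof.
move=> pi /(congr1 (fun y : morse R S (Some n.+1) => \val y)) /=.
rewrite collapse_essential//; last exact: cell_ofE.
have [k [e [u [kn eE ui ->]]]] := set_valP z.
move/(chi_cell_inj (essential_cell (cell_ofE _)) pi (essential_cell eE) ui).
by move/simplex_point_dim => nk; move: kn; rewrite -nk /= ltnn.
Qed.

Lemma cell_map_inside_inj p q : inside (disk_to_simplex p.2) ->
  inside (disk_to_simplex q.2) -> cell_map p = cell_map q -> p = q.
Proof.
move=> pi qi /(congr1 (fun y : morse R S (Some n.+1) => \val y)) /=.
rewrite !collapse_essential//; try exact: cell_ofE.
move/(chi_cell_inj (essential_cell (cell_ofE _)) pi (essential_cell (cell_ofE _)) qi).
move/simplex_point_inj => [pq1 /(can_inj (@disk_to_simplexK _ _)) pq2].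
rewrite [p]surjective_pairing [q]surjective_pairing pq2; congr (_, _).
exact: set_type_inj.
Qed.

(** Two maps that agree on the attached spheres define a function on the
    skeleton, as open cells and the lower skeleton are disjoint; its continuity is
    immediate from the final topology, once each closed cell is reparametrised by a
    ball. *)
Lemma skel_pushout : @is_pushout M (prod_mspace (cell_mset n.+1) sphere)
  (morse_mspace (Some n)) (prod_mspace (cell_mset n.+1) disk)
  (morse_mspace (Some n.+1)) attaching_map (fun p => (p.1, sphere_incl p.2))
  (@skel_incl n) cell_map.
Proof.
split; [exact: attaching_map_mmap|exact: sphere_incl_mmap|exact: widen_mmap|
  exact: cell_map_mmap|split].
  by apply/funext => p; exact: skel_incl_attaching_map.
move=> Z u v [uc ua] [vc va] uv.
have uvE s : u (attaching_map s) = v (s.1, sphere_incl s.2).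
  exact: (congr1 (fun f => f s) uv).
have cell_map_incl p z : cell_map p = skel_incl z -> v p = u z.
  have [pi /(cell_map_inside_not_incl pi)//|[s ->]] := sphereP p.
  by rewrite -(skel_incl_attaching_map (p.1, s)) => /widen_inj <-; rewrite uvE.
have cell_map_eq p q : cell_map p = cell_map q -> v p = v q.
  have [pi|[s ->]] := sphereP p; last first.
    by rewrite -(skel_incl_attaching_map (p.1, s)) => /esym/cell_map_incl ->; rewrite uvE.
  have [qi|[s ->]] := sphereP q; first by move=> /cell_map_inside_inj ->.
  by rewrite -(skel_incl_attaching_map (q.1, s)) => /cell_map_incl ->; rewrite uvE.
have wex y : exists z, (forall x, y = skel_incl x -> z = u x) /\
    (forall p, y = cell_map p -> z = v p).
  have [[x ->]|[p ->]] := skel_cases y.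
    exists (u x); split=> [x' /widen_inj -> //|p /esym/cell_map_incl //].
  exists (v p); split=> [x|q]; [exact: cell_map_incl|exact: cell_map_eq].
have [w wP] := choice wex.
have wi x : w (skel_incl x) = u x by have [+ _] := wP (skel_incl x); apply.
have wc p : w (cell_map p) = v p by have [_] := wP (cell_map p); apply.
exists w; split; first split.
- split=> [|m y]; last first.
    have [[x ->]|[p ->]] := skel_cases y.
      by rewrite wi -ua -wi; congr w; exact: set_type_inj.
    by rewrite wc -va -wc; congr w; rewrite (cell_map_mmap.2).
  apply: out_of_morse_continuous => k e kn eE.
  have := kn; rewrite /= leq_eqVlt => /orP[/eqP kn1|kn'].
    subst k; rewrite (_ : w \o _ = fun t => v (SigSub (mem_set eE), simplex_to_disk t)).
      apply: (@cont_comp _ _ _ (fun t =>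
        (SigSub (mem_set eE) : discrete_topology (cell_mset n.+1),
         simplex_to_disk t)) v) => //.
      apply: continuous_pair; first exact: cst_continuous.
      exact: simplex_to_disk_continuous.
    by apply/funext => t /=; rewrite (morse_chi_cell_map eE) wc.
  rewrite (_ : w \o _ = u \o morse_chi S e (kn' : dim_ok (Some n) k)).
    exact: cont_comp (@morse_chi_continuous _ _ _ _ _ _ _) uc.
  apply/funext => t /=; rewrite -wi; congr w; exact: set_type_inj.
- exact/funext.
- exact/funext.
- move=> w' [_ w'i w'c]; apply/funext => y.
  have [[x ->]|[p ->]] := skel_cases y; first by rewrite wi -w'i.
  by rewrite wc -w'c.
Qed.

End attaching.

(** A point belongs to all skeleta from the dimension of its carrier on, and
    compatible maps take the same value on all its copies. *)
Lemma skel_colimit :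
  is_seq_colimit (X_ := fun n => morse_mspace (Some n)) skel_incl skel_inj.
Proof.
split; [by move=> n; exact: widen_mmap|by move=> n; exact: widen_mmap| |].
  by move=> n; apply/funext => y; exact: set_type_inj.
move=> Z u um uS.
have u_chi n k (e : K k) (kn : dim_ok (Some n) k) (t : Delta k) :
    u n (morse_chi S e kn t) = u k (morse_chi S e (dim_ok_refl k) t).
  elim: n => [|n IH] in kn *.
    have kz : k = 0 by apply/eqP; rewrite -leqn0.
    by subst k; congr (u 0 _); exact: set_type_inj.
  have := kn; rewrite /= leq_eqVlt => /orP[/eqP kn1|kn'].
    by subst k; congr (u _ _); exact: set_type_inj.
  rewrite -(IH kn') -[in RHS](uS n) /=; congr (u _ _); exact: set_type_inj.
have wex y : exists z, forall n x, y = skel_inj x -> z = u n x.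
  have [k [e [t [kN [eE ti ye]]]]] := morse_point y.
  exists (u k (morse_chi S e (dim_ok_refl k) t)) => n x yx.
  have [l [f [s [ln [fE si def_x]]]]] := morse_point x.
  have : chi e t = chi f s.
    have /(congr1 (fun z : morse R S None => \val z)) : morse_chi S e kN t = skel_inj x.
      by rewrite -ye.
    by rewrite def_x /= !collapse_essential.
  move/(chi_cell_inj (essential_cell eE) ti (essential_cell fE) si) => etfs.
  have ? := simplex_point_dim etfs; subst l.
  by have [? ?] := simplex_point_inj etfs; subst f s; rewrite def_x u_chi.
have [w wP] := choice wex.
have wj n x : w (skel_inj x) = u n x by exact: wP.
have cases y : exists n x, y = @skel_inj n x.
  have [k [e [t [kN [eE ti ->]]]]] := morse_point y.
  by exists k, (morse_chi S e (dim_ok_refl k) t); exact: set_type_inj.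
exists w; split; first split.
- split=> [|m y]; last first.
    have [n [x ->]] := cases y; rewrite wj -(um n).2 -wj; congr w.
    exact: set_type_inj.
  apply: out_of_morse_continuous => k e kN eE.
  rewrite (_ : w \o _ = u k \o morse_chi S e (dim_ok_refl k)).
    exact: cont_comp (@morse_chi_continuous _ _ _ _ _ _ _) (um k).1.
  by apply/funext => t /=; rewrite -wj; congr w; exact: set_type_inj.
- by move=> n; apply/funext => x; exact: wj.
- move=> w' [_ w'j]; apply/funext => y; have [n [x ->]] := cases y.
  by rewrite wj -(w'j n).
Qed.

Definition morse_complex : free_mcw R M := FreeMCW
  (fun n => ex_intro _ _ (cell_mset_free n)) zero_skel_miso skel_pushout skel_colimit.

Local Notation X := (realisation_mspace R K).
Local Notation Y := (morse_mspace None).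

Lemma collapse_in_all p : essential_points S None (collapse p).
Proof. by have [n [x [u ->]]] := chi_surj p; exact: collapse_in. Qed.

Definition to_morse (p : X) : Y := SigSub (mem_set (collapse_in_all p)).

Definition from_morse (y : Y) : X := flow (\val y) 1.

Lemma to_morse_mmap : is_mmap to_morse.
Proof.
split=> [|m p]; last by apply: set_type_inj; exact: collapse_act.
apply: (final_continuous (realisation_final R K)) => -[n x] /=.
apply: into_subtype_continuous.
exact: (@collapse_simplex_continuous R K S None n x isT).
Qed.

(** Continuity is tested on essential cells, where [flow1_collapse] replaces
    [collapse (chi e u)] by [chi e u]. *)
Lemma from_morse_mmap : is_mmap from_morse.
Proof.
split=> [|m y]; last exact: flow_act.
apply: out_of_morse_continuous => k e kN eE.
rewrite (_ : _ \o _ = fun u => flow (chi e u) 1).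
  apply: (@cont_comp _ _ _ (fun u => (chi e u, 1 : R)) _ _ (@flow_continuous R K S)).
  by apply: continuous_pair; [exact: chi_continuous|exact: cst_continuous].
by apply/funext => u; rewrite /from_morse /= flow1_collapse.
Qed.

Lemma to_morseK p : from_morse (to_morse p) = flow p 1.
Proof. by rewrite /from_morse /= flow1_collapse. Qed.

Lemma interval_continuous : continuous (fun t : unit_interval R => 1 - \val t).
Proof.
apply: contD; first exact: cst_continuous.
by apply: contN; exact: val_continuous.
Qed.

Lemma realisation_homotopy : mhomotopic R (from_morse \o to_morse) idfun.
Proof.
exists (fun q : X * unit_interval R => flow q.1 (1 - \val q.2) : X); split.
- apply: (@cont_comp _ _ _ (fun q : X * unit_interval R => (q.1, 1 - \val q.2)) _ _
    (@flow_continuous R K S)).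
  apply: continuous_pair; first exact: fst_continuous.
  exact: cont_comp (@snd_continuous _ _) interval_continuous.
- by move=> m x t; exact: flow_act.
- by move=> x t /= ->; rewrite subr0 -to_morseK.
- by move=> x t /= ->; rewrite subrr flow_start.
Qed.

Lemma morse_homotopy_continuous :
  continuous (fun q : Y * R => to_morse (flow (\val q.1) q.2)).
Proof.
apply: (@final_homotopy_continuous R Y _ _ _ Y _ (morse_final R S None)).
move=> -[k [e [kN eE]]] /=.
rewrite (_ : (fun _ => _) = fun p : Delta k * R => to_morse (flow (chi e p.1) p.2)).
  apply: cont_comp to_morse_mmap.1.
  apply: (@cont_comp _ _ _ (fun p : Delta k * R => (chi e p.1, p.2)) _ _
    (@flow_continuous R K S)).
  apply: continuous_pair; last exact: snd_continuous.
  exact: cont_comp (@fst_continuous _ _) (@chi_continuous _ _ _ _).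
by apply/funext => p; apply: set_type_inj => /=; rewrite collapse_flow.
Qed.

Lemma morse_homotopy : mhomotopic R (to_morse \o from_morse) idfun.
Proof.
exists (fun q : Y * unit_interval R => to_morse (flow (\val q.1) (1 - \val q.2))).
split.
- apply: (@cont_comp _ _ _ (fun q : Y * unit_interval R => (q.1, 1 - \val q.2)) _ _
    morse_homotopy_continuous).
  apply: continuous_pair; first exact: fst_continuous.
  exact: cont_comp (@snd_continuous _ _) interval_continuous.
- by move=> m y t; apply: set_type_inj; rewrite /= flow_act collapse_act.
- by move=> y t /= ->; rewrite subr0.
- move=> y t /= ->; apply: set_type_inj; rewrite /= subrr flow_start//.
  by apply: collapse_id; exact: (set_valP y).
Qed.

Lemma morse_equivalent : mhomotopy_equivalent R morse_complex X.
Proof.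
exists from_morse, to_morse; split; [exact: from_morse_mmap|exact: to_morse_mmap| |].
  exact: morse_homotopy.
exact: realisation_homotopy.
Qed.

End equivariance.

Theorem theorem9p6 (R : realType) (M : monoidType) (K : rigid_msset M)
    (S : collapsing_scheme K) (B : forall n, set (K n)) :
  free_msset K ->
  equivariant_scheme S B ->
  exists Y : free_mcw R M,
    mhomotopy_equivalent R Y (realisation_mspace R K) /\
    exists phi : forall n, cw_cells Y n -> K n,
      forall n,
        [/\ set_bij [set: cw_cells Y n] (@essential K S n) (phi n),
            forall (m : M) (p : cw_cells Y n),
              phi n (mact m p) = sact m (phi n p) &
            free_with_basis (@mact M (cw_cells Y n)) [set: cw_cells Y n]
              (phi n @^-1` (@essential K S n `&` B n))].
Proof.
move=> _ eqS; exists (morse_complex R eqS); split; first exact: morse_equivalent.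
exists (fun n (e : cell_mset eqS n) => \val e : K n) => n; split=> //.
- split=> [e _|e f _ _|x xE]; [exact: (set_valP e)|exact: set_type_inj|].
  by exists (SigSub (mem_set xE)).
- exact: cell_mset_free.
Qed.
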